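(* Let $r\in(0,1)$, $\alpha>0$ and $\beta\in\mathbb{R}$. (i) For every $x\in\mathbb{R}$, every function $f\in C^{\alpha,r}_{\beta}L_{\infty}$ and every $n\ge n_{*}(\alpha,r,\infty)$, $$|\tilde\rho_n(f;x)|\le 2e^{-\alpha n^{r}}\left|\sin\frac{2n-1}{2}x\right|\left(\frac{4}{\pi^2}\ln\frac{n^{1-r}}{\alpha r}+\gamma^{*}_{n,\infty}\right)E_n(f^{\alpha,r}_{\beta})_{L_\infty},$$ where the quantity $\gamma^{*}_{n,\infty}=\gamma^{*}_{n,\infty}(\alpha,r,\beta,x)$ satisfies $|\gamma^{*}_{n,\infty}|<20\pi^{4}$. (ii) Moreover, for every $x\in\mathbb{R}$, every function $f\in C^{\alpha,r}_{\beta}C$ and every $n\ge n_{*}(\alpha,r,\infty)$ there exists a function $\mathcal{F}(\cdot)=\mathcal{F}(f;n;x;\cdot)\in C^{\alpha,r}_{\beta}C$ such that $E_n(\mathcal{F}^{\alpha,r}_{\beta})_{C}=E_n(f^{\alpha,r}_{\beta})_{C}$ and $$|\tilde\rho_n(\mathcal{F};x)|=2e^{-\alpha n^{r}}\left|\sin\frac{2n-1}{2}x\right|\left(\frac{4}{\pi^2}\ln\frac{n^{1-r}}{\alpha r}+\gamma^{**}_{n,\infty}\right)E_n(f^{\alpha,r}_{\beta})_{C},$$ where $\gamma^{**}_{n,\infty}=\gamma^{**}_{n,\infty}(\alpha,r,\beta,f,x)$ satisfies $|\gamma^{**}_{n,\infty}|<1951$.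
   Context: Spaces. $L_1$ is the space of $2\pi$-periodic functions summable over a period; $L_\infty$ is the space of measurable essentially bounded $2\pi$-periodic functions with the essential supremum norm $\|\cdot\|_\infty$; $C$ is the space of continuous $2\pi$-periodic functions with $\|f\|_C=\max_t|f(t)|$. Generalized Poisson integrals. For $\alpha,r>0$, $\beta\in\mathbb{R}$ let $P_{\alpha,r,\beta}(t)=\sum_{k=1}^{\infty}e^{-\alpha k^{r}}\cos\left(kt-\frac{\beta\pi}{2}\right)$. For $\mathfrak{N}\subset L_1$ (here $\mathfrak{N}=L_\infty$ or $\mathfrak{N}=C$), $C^{\alpha,r}_{\beta}\mathfrak{N}$ is the set of $2\pi$-periodic functions $f$ representable for all $x\in\mathbb{R}$ as $$f(x)=\frac{a_0}{2}+\frac1\pi\int_{-\pi}^{\pi}P_{\alpha,r,\beta}(x-t)\varphi(t)\,dt,\quad a_0\in\mathbb{R},\ \varphi\in\mathfrak{N},\ \int_{-\pi}^{\pi}\varphi(t)\,dt=0.$$ The function $\varphi$ (determined up to a null set; the continuous representative is taken when $\mathfrak{N}=C$) is called the generalized derivative of $f$ and denoted $f^{\alpha,r}_{\beta}$. Interpolation polynomials. For $f\in C$, $\tilde S_{n-1}(f;\cdot)$ is the unique trigonometric polynomial of order at most $n-1$ with $\tilde S_{n-1}(f;x_k^{(n-1)})=f(x_k^{(n-1)})$, $k=0,1,\dots,2n-2$, where $x_k^{(n-1)}=\frac{2k\pi}{2n-1}$. Put $\tilde\rho_n(f;x)=f(x)-\tilde S_{n-1}(f;x)$. Best approximation. $\mathcal{T}_{2n-1}$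 is the space of trigonometric polynomials of order at most $n-1$; $E_n(g)_{L_\infty}=\inf_{t_{n-1}\in\mathcal{T}_{2n-1}}\|g-t_{n-1}\|_\infty$ and $E_n(g)_{C}=\inf_{t_{n-1}\in\mathcal{T}_{2n-1}}\|g-t_{n-1}\|_C$. The number $n_*$. For $\alpha>0$, $r\in(0,1)$, $n_*(\alpha,r,\infty)$ is the smallest $n\in\mathbb{N}$ such that $$\frac{\ln(\pi n)}{\alpha r n^{r}}+\frac{\alpha r}{n^{1-r}}\le\frac1{(3\pi)^3}.$$
   Formalization: In (i) and (ii), besides n ≥ n_*, the inequality defining n_* is assumed to hold at n itself; for very small r it can fail at some n > n_*, and the claim as stated is then false (e.g. αr = 5·10⁴, β = 1, n ≈ e^{1/r}, r → 0). *)

(* Defs.v *)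
From mathcomp Require Import all_boot all_order all_algebra.
From mathcomp Require Import all_classical all_reals all_analysis.

Set Implicit Arguments.
Unset Strict Implicit.
Unset Printing Implicit Defensive.

Import Order.TTheory GRing.Theory Num.Theory.
Import numFieldNormedType.Exports.

Local Open Scope classical_set_scope.
Local Open Scope ring_scope.

Definition Cper (R : realType) : set (R -> R) :=
  [set g : R -> R | periodic g (2 * pi) /\ continuous g].

(* By periodicity, the essential supremum over the real line is the one over a
   period. *)
Definition Linfty (R : realType) : set (R -> R) :=
  [set g : R -> R | [/\ periodic g (2 * pi),
               measurable_fun [set: measurableTypeR R] g
             & (Lnorm (@lebesgue_measure R) +oo (EFin \o g) < +oo)%E]].

Arguments Cper : clear implicits.
Arguments Linfty : clear implicits.

Definition poisson_kernel (R : realType) (alpha r beta t : R) : R :=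
  limn (fun N => \sum_(1 <= k < N)
    expR (- alpha * k%:R `^ r) * cos (k%:R * t - beta * pi / 2)).

(* [gen_derivative N alpha r beta f phi] says that f belongs to the class of
   generalized Poisson integrals over N and that phi is its generalized
   derivative, which is unique up to a null set. *)
Definition gen_derivative (R : realType) (N : set (R -> R))
    (alpha r beta : R) (f phi : R -> R) : Prop :=
  [/\ periodic f (2 * pi), N phi,
      \int[@lebesgue_measure R]_(t in `[- pi, pi]) phi t = 0
    & exists a0 : R, forall x : R,
        f x = a0 / 2 + pi^-1 *
          \int[@lebesgue_measure R]_(t in `[- pi, pi])
            (poisson_kernel alpha r beta (x - t) * phi t)].

(* Trigonometric polynomials of order at most n - 1 (only used for 0 < n). *)
Definition trig_space (R : realType) (n : nat) : set (R -> R) :=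
  [set t | exists a b : nat -> R, t = fun x =>
     \sum_(k < n) (a k * cos (k%:R * x) + b k * sin (k%:R * x))].

(* [En_Linfty n g] and [En_C n g] are the distances from g to trig_space n. *)
Definition En_Linfty (R : realType) (n : nat) (g : R -> R) : R :=
  fine (ereal_inf [set Lnorm (@lebesgue_measure R) +oo
                         (fun x => (g x - t x)%:E) | t in trig_space n]).

Definition supnorm (R : realType) (g : R -> R) : R :=
  sup [set `|g x| | x in [set: R]].

Definition En_C (R : realType) (n : nat) (g : R -> R) : R :=
  inf [set supnorm (fun x => g x - t x) | t in trig_space n].

Definition interp_node (R : realType) (n k : nat) : R :=
  2 * k%:R * pi / (2 * n - 1)%N%:R.

(* Choice of the unique interpolant; the default value is never reached for
   0 < n. *)
Definition interp_poly (R : realType) (n : nat) (f : R -> R) : R -> R :=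
  xget (fun=> 0) [set t : R -> R | trig_space n t /\
    forall k : nat, (k < 2 * n - 1)%N ->
      t (interp_node R n k) = f (interp_node R n k)].

Definition interp_error (R : realType) (n : nat) (f : R -> R) (x : R) : R :=
  f x - interp_poly n f x.

Definition nstar_ineq (R : realType) (alpha r : R) (n : nat) : Prop :=
  ln (pi * n%:R) / (alpha * r * n%:R `^ r) + alpha * r / n%:R `^ (1 - r)
    <= 1 / (3 * pi) ^+ 3.

(* Since ln (pi n) / n^r increases as long as ln (pi n) < 1 / r, the inequality
   may fail for some n >= nstar when r is small; it holds for all n >= nstar
   as soon as r >= 1 / 18. *)
Definition nstar (R : realType) (alpha r : R) : nat :=
  xget 0%N [set n | [/\ (0 < n)%N, nstar_ineq alpha r n
    & forall m : nat, (0 < m)%N -> nstar_ineq alpha r m -> (n <= m)%N]].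

(* Main.v *)
Require Import Defs.
From mathcomp Require Import all_boot all_order all_algebra.
From mathcomp Require Import all_classical all_reals all_analysis.
From mathcomp Require Import measurable_realfun ess_sup_inf.
From mathcomp Require Import ring lra zify.

Import Order.TTheory GRing.Theory Num.Theory.
Import numFieldNormedType.Exports.

(** Write N = 2n - 1, h = 2 pi / N and q = alpha r / n^(1 - r). Interpolation replaces the
    harmonic of order j + m N with |j| < n by the one of order j, so that the error at
    x is (1 / pi) times the integral of Q phi, where the kernel Q only contains harmonics
    of order at least n in the integration variable t. Hence phi may be replaced by phi - T
    for any trigonometric polynomial T of order less than n. The harmonics of order at
    least 3n - 1 contribute a bounded multiple of exp (- alpha n^r) |sin (N x / 2)|, and
    the others add up to 2 exp (- alpha n^r) sin (N x / 2) G (t - x), where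
      G u = sum over n <= k < 3n - 1 of b_k sin (k u + xi),
      b_k = exp (alpha n^r - alpha k^r).
    As b is convex and decreasing with b_n - b_(n+1) <= q, two summations by parts give
    G u = cos (N u / 2 + xi) / (2 sin (u / 2)) + O (q / u^2), while |G| <= 4 / q.
    Since |cos (N u / 2 + xi)| has period h, summing |G| over the N translates by
    multiples of h leaves harmonic sums, and the integral of |G| over a period is
    (4 / pi) ln (1 / q) + O (1). This gives (i).
    For (ii), the derivative G / (|G| + 1) (minus its mean) attains the norm of G up to
    O (1) and has best approximation at most 1; it is rescaled to the prescribed value.
    The resulting gamma is at most 34 in absolute value, far below 20 pi^4 and 1951. *)

Set Implicit Arguments.
Unset Strict Implicit.
Unset Printing Implicit Defensive.

Local Open Scope classical_set_scope.
Local Open Scope ring_scope.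

(** * Trigonometric interpolation *)

(** The condition at n enters only through q <= 1/216 and q n >= 216 ln (pi n); about pi, the
    estimates need little more than 2 <= pi <= 4. The first bound makes G long compared with its
    oscillation, the second gives b_k <= k^-3 from k = 2n on. The obstacle is the integral of |G|,
    since the approximation by |cos (N u / 2 + xi)| / |2 sin (u / 2)| is useful only for |u| above
    q. Cutting at |u| about q makes both the bound 4 / q inside and the error q / u^2 outside
    contribute O(1). What remains is 2 ln (1 / q), from the two sides of 0, times the mean 2 / pi of
    |cos|; division by pi gives 4 / pi^2. Folding along translates by h replaces the analysis of an
    oscillating integrand by a sum in which the numerator is constant. In (ii) the sign of G is not
    continuous, hence the smoothing. Its best approximation E_n is only known to be at most 1, which
    is the favourable direction: reaching the prescribed value then needs a larger factor. That E_n
    is positive follows from the upper bound of (i), without duality. The same upper bound controls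
    gamma from above. *)

Lemma sin_mul_cos2 (R : realType) (a b : R) :
  2 * sin a * cos b = sin (b + a) - sin (b - a).
Proof. by rewrite sinB sinD; ring. Qed.

Lemma sin_mul_sin2 (R : realType) (a b : R) :
  2 * sin a * sin b = cos (b - a) - cos (b + a).
Proof. by rewrite cosB cosD; ring. Qed.

Lemma cosB_cos (R : realType) (a b : R) :
  cos a - cos b = - (2 * sin ((a + b) / 2) * sin ((a - b) / 2)).
Proof.
rewrite -mulrA (mulrC (sin _)) mulrA sin_mul_sin2.
have -> : (a + b) / 2 - (a - b) / 2 = b by field.
have -> : (a + b) / 2 + (a - b) / 2 = a by field.
by ring.
Qed.

Lemma cosDn2pi (R : realType) (x : R) (k : nat) :
  cos (x + 2 * pi * k%:R) = cos x.
Proof.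
have -> : 2 * pi * k%:R = (pi *+ 2) *+ k :> R.
  by rewrite -[RHS]mulr_natr -[in RHS](mulr_natl pi).
exact: (periodicn (@cosD2pi R)).
Qed.

Lemma sinDn2pi (R : realType) (x : R) (k : nat) :
  sin (x + 2 * pi * k%:R) = sin x.
Proof.
have -> : 2 * pi * k%:R = (pi *+ 2) *+ k :> R.
  by rewrite -[RHS]mulr_natr -[in RHS](mulr_natl pi).
exact: (periodicn (@sinD2pi R)).
Qed.

Lemma normr_cosDnpi (R : realType) (x : R) (k : nat) :
  `|cos (x + k%:R * pi)| = `|cos x|.
Proof.
elim: k => [|k IH]; first by rewrite mul0r addr0.
by rewrite -IH -natr1 mulrDl mul1r addrA cosDpi normrN.
Qed.

Lemma normr_sin_natM (R : realType) (m : nat) (x : R) :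
  `|sin (m%:R * x)| <= m%:R * `|sin x|.
Proof.
elim: m => [|m IH]; first by rewrite !mul0r sin0 normr0.
rewrite -natr1 !mulrDl !mul1r sinD (le_trans (ler_normD _ _))// !normrM lerD//.
  apply: le_trans IH; rewrite -[leRHS]mulr1 ler_pM//; exact: cos_max.
by rewrite -[leRHS]mul1r ler_pM//; exact: cos_max.
Qed.

(** Multiplication by 2 sin (d / 2), with d the common difference of the angles, telescopes the sum,
    and N d = 2 pi m makes the two end terms equal. The bounds on m give 0 < d / 2 < pi, so the
    factor can be cancelled. *)
Lemma sum_cos_arith_eq0 (R : realType) (m N : nat) (th : R) :
  (0 < m < N)%N ->
  \sum_(k < N) cos (m%:R * (2 * pi / N%:R) * k%:R + th) = 0.
Proof.
move=> /andP[m0 mN].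
have N0 : N%:R != 0 :> R by rewrite pnatr_eq0 -lt0n (ltn_trans m0).
set d := m%:R * (2 * pi / N%:R).
have s0 : 2 * sin (d / 2) != 0 :> R.
  rewrite mulf_neq0//; rewrite gt_eqF// sin_gt0_pi//.
  have -> : d / 2 = m%:R / N%:R * pi by rewrite /d; field.
  have N_gt0 : (0 < N)%N by exact: ltn_trans mN.
  rewrite mulr_gt0 ?pi_gt0 ?divr_gt0 ?ltr0n//=.
  rewrite gtr_pMl ?pi_gt0// ltr_pdivrMr ?ltr0n//.
  by rewrite mul1r ltr_nat.
apply: (mulfI s0); rewrite mulr0 mulr_sumr.
pose f k := sin (d * k%:R + th - d / 2).
under eq_bigr => k _.
  rewrite sin_mul_cos2.
  have -> : d * k%:R + th + d / 2 = d * k.+1%:R + th - d / 2.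
    by rewrite -natr1; field.
  rewrite -/(f k.+1) -/(f k).
  over.
rewrite -(big_mkord xpredT (fun k => f k.+1 - f k)) telescope_sumr//.
rewrite /f mulr0 add0r.
have -> : d * N%:R + th - d / 2 = th - d / 2 + 2 * pi * m%:R.
  by rewrite /d; field.
by rewrite sinDn2pi subrr.
Qed.

Lemma sum_cos_arith_sign_eq0 (R : realType) (i j N : nat) (th : R) :
  i != j -> (i < N)%N -> (j < N)%N ->
  \sum_(k < N) cos ((i%:R - j%:R) * (2 * pi / N%:R) * k%:R + th) = 0.
Proof.
move=> ij iN jN; have [ltij|ltji|/eqP] := ltngtP i j; last by rewrite (negPf ij).
- rewrite -[RHS](@sum_cos_arith_eq0 R (j - i) N (- th)).
    apply: eq_bigr => k _; rewrite -[LHS]cosN natrB ?(ltnW ltij)//.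
    by congr cos; ring.
  by rewrite subn_gt0 ltij (leq_ltn_trans (leq_subr _ _)).
- rewrite -[RHS](@sum_cos_arith_eq0 R (i - j) N th).
    by apply: eq_bigr => k _; rewrite natrB ?(ltnW ltji)//.
  by rewrite subn_gt0 ltji (leq_ltn_trans (leq_subr _ _)).
Qed.

(** * Dirichlet kernel, aliasing and the interpolation operator *)

Definition dirichlet (R : realType) (p : nat) (u : R) : R :=
  (p.*2.+1)%:R^-1 * \sum_(i < p.*2.+1) cos ((i%:R - p%:R) * u).

(** The sine half of the addition formula vanishes, because i -> 2p - i changes the sign of i - p. A
    cosine times the Dirichlet kernel is thus an average of shifted cosines. *)
Lemma sum_cosD_dirichlet (R : realType) (p : nat) (a u : R) :
  \sum_(i < p.*2.+1) cos (a + (i%:R - p%:R) * u) =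
  cos a * \sum_(i < p.*2.+1) cos ((i%:R - p%:R) * u).
Proof.
set rhs := RHS.
have -> : rhs = rhs - sin a * \sum_(i < p.*2.+1) sin ((i%:R - p%:R) * u).
  suff -> : \sum_(i < p.*2.+1) sin ((i%:R - p%:R) * u) = 0 by rewrite mulr0 subr0.
  set s := LHS; suff : s = - s by move=> /eqP; rewrite -addr_eq0 -mulr2n mulrn_eq0 => /eqP.
  rewrite {1}/s (reindex_inj rev_ord_inj)/= /s -sumrN; apply: eq_bigr => i _.
  rewrite -sinN subSS natrB; last by rewrite -ltnS.
  congr sin; have -> : p.*2%:R = p%:R + p%:R :> R by rewrite -addnn natrD.
  by ring.
rewrite /rhs !mulr_sumr -sumrB; apply: eq_bigr => i _.
by rewrite cosD.
Qed.

(* At the 2p + 1 nodes, the harmonic of order k coincides with that of order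
   k - (alias_order p k) (2p + 1), which lies in [-p, p]. *)
Definition alias_order (p k : nat) := ((k + p) %/ p.*2.+1)%N.

Lemma alias_order0 p k : (k <= p)%N -> alias_order p k = 0%N.
Proof. by move=> kp; rewrite /alias_order divn_small//; lia. Qed.

(** The upper end 3p + 1 = 3n - 2 is the last order that is folded exactly once; this is why the
    main kernel stops before 3n - 1. *)
Lemma alias_order1 p k : (p < k <= 3 * p + 1)%N -> alias_order p k = 1%N.
Proof.
move=> kp; have E : (k + p)%N = (1 * p.*2.+1 + (k + p - p.*2.+1))%N by lia.
by rewrite /alias_order E divnMDl// divn_small//; lia.
Qed.

(** A crude bound suffices: in the tail the alias order only costs a factor k, absorbed by
    coefficients of size k^-3. *)
Lemma alias_order_le p k : (alias_order p k <= k)%N.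
Proof.
have [kp|pk] := leqP k p; first by rewrite alias_order0.
rewrite /alias_order -ltnS ltn_divLR//; nia.
Qed.

Section interpolation.
Variables (R : realType) (p : nat).
Let N := p.*2.+1.
Let Nr0 : N%:R != 0 :> R. Proof. by rewrite pnatr_eq0. Qed.

Lemma natN_half : N%:R = 2 * p%:R + 1 :> R.
Proof. by rewrite /N -natr1 -mul2n natrM. Qed.

Lemma interp_nodeE k : interp_node R p.+1 k = 2 * pi / N%:R * k%:R.
Proof.
rewrite /interp_node; have -> : (2 * p.+1 - 1)%N = N by rewrite /N; lia.
by field.
Qed.

Lemma dirichlet_node (j k : nat) : (j < N)%N -> (k < N)%N ->
  dirichlet p (interp_node R p.+1 j - interp_node R p.+1 k) = (j == k)%:R.
Proof.
move=> jN kN; rewrite /dirichlet.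
have [->|jk] := eqVneq j k.
  rewrite subrr (eq_bigr (fun=> 1)); last by move=> i _; rewrite mulr0 cos0.
  by rewrite sumr_const card_ord mulVf.
rewrite (_ : \sum_(i < _) _ = 0) ?mulr0//.
rewrite -[RHS](@sum_cos_arith_sign_eq0 R j k N
  (- p%:R * (interp_node R p.+1 j - interp_node R p.+1 k)))//.
apply: eq_bigr => i _; rewrite !interp_nodeE; congr cos; by field.
Qed.

(** Once the product is expanded and the sums are exchanged, each i contributes a sum over the nodes
    of cosines of frequency j - i. It vanishes for i <> j, and for i = j its N terms all equal the
    value at x. *)
Lemma dirichlet_reproducing (j : nat) (th x : R) : (j < N)%N ->
  \sum_(k < N) cos ((j%:R - p%:R) * interp_node R p.+1 k + th) *
     dirichlet p (x - interp_node R p.+1 k) = cos ((j%:R - p%:R) * x + th).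
Proof.
move=> jN; rewrite /dirichlet -/N.
under eq_bigr => k _ do rewrite mulrCA -sum_cosD_dirichlet -/N.
rewrite -mulr_sumr exchange_big/= (bigD1 (Ordinal jN))//= [X in _ + X]big1 ?addr0.
  rewrite (eq_bigr (fun=> cos ((j%:R - p%:R) * x + th))).
    by rewrite sumr_const card_ord -[X in _ * X]mulr_natl mulrA mulVf ?mul1r.
  by move=> k _; congr cos; ring.
move=> i ij; rewrite -[RHS](@sum_cos_arith_sign_eq0 R j i N
   ((i%:R - p%:R) * x + th))//.
  by apply: eq_bigr => k _; rewrite !interp_nodeE; congr cos; field.
by apply: contra ij => /eqP ji; apply/eqP/val_inj.
Qed.

Lemma trig_space0 n : @trig_space R n (fun=> 0).
Proof.
exists (fun=> 0), (fun=> 0); apply/funext => x.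
by rewrite big1// => i _; rewrite !mul0r addr0.
Qed.

Lemma trig_spaceD n (t u : R -> R) : @trig_space R n t -> @trig_space R n u ->
  @trig_space R n (fun x => t x + u x).
Proof.
move=> [a [b ->]] [c [d ->]]; exists (fun k => a k + c k), (fun k => b k + d k).
by apply/funext => x; rewrite -big_split/=; apply: eq_bigr => i _; ring.
Qed.

Lemma trig_spaceZ n (c : R) (t : R -> R) : @trig_space R n t ->
  @trig_space R n (fun x => c * t x).
Proof.
move=> [a [b ->]]; exists (fun k => c * a k), (fun k => c * b k).
by apply/funext => x; rewrite mulr_sumr; apply: eq_bigr => i _; ring.
Qed.

Lemma trig_space_sum n m (t : 'I_m -> R -> R) :
  (forall i, @trig_space R n (t i)) -> @trig_space R n (fun x => \sum_(i < m) t i x).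
Proof.
elim: m t => [|m IH] t tn.
  by under eq_fun do rewrite big_ord0; exact: trig_space0.
under eq_fun do rewrite big_ord_recl; apply: trig_spaceD; first exact: tn.
by apply: IH => i; exact: tn.
Qed.

Lemma trig_space_cos n j (th : R) : (j < n)%N ->
  @trig_space R n (fun x => cos (j%:R * x + th)).
Proof.
move=> jn; exists (fun k => (k == j)%:R * cos th), (fun k => - (k == j)%:R * sin th).
apply/funext => x; rewrite (bigD1 (Ordinal jn))//= big1 ?addr0.
  by rewrite eqxx /= cosD; ring.
move=> i ij; have /negPf -> : (i : nat) != j.
  by apply: contra ij => /eqP ji; apply/eqP/val_inj.
by rewrite !mul0r oppr0 !mul0r addr0.
Qed.

Lemma trig_space_cosB j (th : R) : (j < N)%N ->
  @trig_space R p.+1 (fun x => cos ((j%:R - p%:R) * x + th)).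
Proof.
move=> jN; have [pj|jp] := leqP p j.
  rewrite (_ : (fun _ => _) = fun x => cos ((j - p)%N%:R * x + th)).
    by apply: trig_space_cos; move: jN; rewrite /N; lia.
  by apply/funext => x; rewrite natrB.
rewrite (_ : (fun _ => _) = fun x => cos ((p - j)%N%:R * x - th)).
  by apply: trig_space_cos; lia.
by apply/funext => x; rewrite natrB ?(ltnW jp)// -cosN; congr cos; ring.
Qed.

Definition interp_op (f : R -> R) (x : R) : R :=
  \sum_(k < N) f (interp_node R p.+1 k) * dirichlet p (x - interp_node R p.+1 k).

Lemma trig_space_interp_op f : @trig_space R p.+1 (interp_op f).
Proof.
apply: trig_space_sum => k; apply: trig_spaceZ; rewrite /dirichlet.
apply: trig_spaceZ; apply: trig_space_sum => i.
under eq_fun do rewrite mulrBr.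
exact: trig_space_cosB.
Qed.

Lemma interp_op_node f k : (k < N)%N ->
  interp_op f (interp_node R p.+1 k) = f (interp_node R p.+1 k).
Proof.
move=> kN; rewrite /interp_op (bigD1 (Ordinal kN))//= dirichlet_node// eqxx mulr1.
rewrite big1 ?addr0// => i ik; rewrite dirichlet_node//.
have /negPf -> : k != i by apply: contra ik => /eqP ki; apply/eqP/val_inj.
by rewrite mulr0.
Qed.

Lemma interp_op_cos j (th x : R) : (j < N)%N ->
  interp_op (fun y => cos ((j%:R - p%:R) * y + th)) x = cos ((j%:R - p%:R) * x + th).
Proof. exact: dirichlet_reproducing. Qed.

Lemma interp_op_trig t x : @trig_space R p.+1 t -> interp_op t x = t x.
Proof.
move=> [a [b ->]]; rewrite /interp_op.
under eq_bigr do rewrite mulr_suml.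
rewrite exchange_big/=; apply: eq_bigr => i _.
under eq_bigr do rewrite mulrDl -!(mulrA _ (_ _) (dirichlet _ _)).
rewrite big_split/= -!mulr_sumr.
have iN : (i + p < N)%N by have := ltn_ord i; rewrite /N; lia.
have E (y : R) : i%:R * y = ((i + p)%:R - p%:R) * y by rewrite natrD; ring.
congr (_ * _ + _ * _).
  rewrite E -[in RHS](addr0 (_ * x)) -(interp_op_cos _ x iN); apply: eq_bigr => k _.
  by rewrite E addr0.
rewrite E -cosBpihalf -(interp_op_cos _ x iN); apply: eq_bigr => k _.
by rewrite -cosBpihalf E.
Qed.

(** Every interpolant t of f in the space satisfies t = [interp_op t], which depends only on nodal
    values and so equals [interp_op f]. This is uniqueness; existence rules out the default value of
    [xget]. *)
Lemma interp_polyE f : interp_poly p.+1 f = interp_op f.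
Proof.
have N2 : (2 * p.+1 - 1)%N = N by rewrite /N; lia.
rewrite /interp_poly; case: xgetP => [t _ /= [tn tf]|/(_ (interp_op f))].
  apply/funext => x; rewrite -(interp_op_trig x tn); apply: eq_bigr => k _.
  by rewrite tf// N2.
case; split; first exact: trig_space_interp_op.
by move=> k; rewrite N2; exact: interp_op_node.
Qed.

Lemma interp_errorE f x : interp_error p.+1 f x = f x - interp_op f x.
Proof. by rewrite /interp_error interp_polyE. Qed.

Lemma interp_op_cos_alias (k : nat) (th x : R) :
  interp_op (fun y => cos (k%:R * y + th)) x =
  cos ((((k + p) %% N)%N%:R - p%:R) * x + th).
Proof.
rewrite -interp_op_cos ?ltn_mod//; apply: eq_bigr => i _; congr (_ * _).
rewrite -[RHS](@cosDn2pi R _ (((k + p) %/ N) * i)); congr cos.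
have -> : k%:R = ((k + p) %/ N)%N%:R * N%:R + ((k + p) %% N)%N%:R - p%:R :> R.
  by rewrite -natrM -natrD -divn_eq natrD addrK.
by rewrite interp_nodeE natrM; field.
Qed.

(** The orders before and after aliasing differ by a multiple m N, so the difference of cosines
    splits off sin (m N x / 2). This factor is zero for orders below n, and at the nodes for all
    orders. *)
Lemma interp_error_cos (k : nat) (th x : R) :
  cos (k%:R * x + th) - interp_op (fun y => cos (k%:R * y + th)) x =
  - (2 * sin ((alias_order p k)%:R * (N%:R / 2 * x)) *
     sin (k%:R * x - (alias_order p k)%:R * (N%:R / 2 * x) + th)).
Proof.
rewrite interp_op_cos_alias cosB_cos.
have E : ((k + p) %% N)%N%:R - p%:R = k%:R - (alias_order p k)%:R * N%:R :> R.
  have /(congr1 (fun m => m%:R : R)) := divn_eq (k + p) N.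
  by rewrite !natrD natrM -/(alias_order p k) => H; lra.
rewrite E [in LHS]mulrAC.
by congr (- (2 * sin _ * sin _)); field.
Qed.

End interpolation.

(** * Coefficients of the kernel *)

Section elementary.
Variable R : realType.
Implicit Types x y r : R.

Lemma ln_leB1 x : 0 < x -> ln x <= x - 1.
Proof. by move=> x0; have := @le_ln1Dx R (x - 1); rewrite (addrC 1) subrK; apply; lra. Qed.

Lemma ln_ge1BV x : 0 < x -> 1 - x^-1 <= ln x.
Proof.
move=> x0; have := @ln_leB1 x^-1; rewrite invr_gt0 lnV ?posrE// => /(_ x0); lra.
Qed.

(** Concavity of the logarithm at z = 1 + r (x - 1), the mean of x and 1 with weights r and 1 - r:
    the tangent increments bounding ln x - ln z and - ln z have weighted sum 0. *)
Lemma powR_le1D x r : 0 <= x -> 0 < r -> r < 1 -> x `^ r <= 1 + r * (x - 1).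
Proof.
rewrite le0r => /orP[/eqP ->|x0] r0 r1.
  by rewrite powR0 ?gt_eqF//; lra.
have z0 : 0 < 1 + r * (x - 1) by nra.
rewrite /powR gt_eqF// -[leRHS]lnK ?posrE// ler_expR.
set z := 1 + _ in z0 *.
have h1 : ln x - ln z <= x / z - 1.
  by rewrite -ln_div ?posrE//; apply: ln_leB1; rewrite divr_gt0.
have h2 : - ln z <= 1 / z - 1.
  by rewrite -lnV ?posrE// div1r; apply: ln_leB1; rewrite invr_gt0.
have h3 : r * (x / z - 1) + (1 - r) * (1 / z - 1) = 0.
  by rewrite /z; field; rewrite -/z gt_eqF.
have h4 : r * (ln x - ln z) <= r * (x / z - 1) by rewrite ler_pM2l.
have h5 : (1 - r) * (- ln z) <= (1 - r) * (1 / z - 1) by rewrite ler_pM2l// subr_gt0.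
lra.
Qed.

Lemma powR_ge1D_ln x r : 0 < x -> 1 + r * ln x <= x `^ r.
Proof. by move=> x0; rewrite /powR gt_eqF//; exact: expR_ge1Dx. Qed.

Lemma powRB_le (a b r : R) : 0 < a -> 0 <= b -> 0 < r -> r < 1 ->
  b `^ r - a `^ r <= a `^ r * (r * (b / a - 1)).
Proof.
move=> a0 b0 r0 r1.
have -> : b `^ r = a `^ r * (b / a) `^ r.
  by rewrite -powRM ?divr_ge0// ?(ltW a0)// mulrCA divff ?mulr1// gt_eqF.
have := @powR_le1D (b / a) r (divr_ge0 b0 (ltW a0)) r0 r1.
have := @powR_gt0 R a r a0; nra.
Qed.

Lemma powRB_ge (a b r : R) : 0 < a -> 0 < b ->
  a `^ r * (r * ln (b / a)) <= b `^ r - a `^ r.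
Proof.
move=> a0 b0.
have -> : b `^ r = a `^ r * (b / a) `^ r.
  by rewrite -powRM ?divr_ge0// ?(ltW a0) ?(ltW b0)// mulrCA divff ?mulr1// gt_eqF.
have := @powR_ge1D_ln (b / a) r (divr_gt0 b0 a0).
have := @powR_gt0 R a r a0; nra.
Qed.

(** The tangent at k + 1 dominates both neighbours and its two increments cancel. The case k = 0 is
    the reason why [powRB_le] admits b = 0. *)
Lemma concave_powR_nat (k : nat) r : 0 < r -> r < 1 ->
  k%:R `^ r + k.+2%:R `^ r <= 2 * k.+1%:R `^ r :> R.
Proof.
move=> r0 r1; have k0 : 0 < k.+1%:R :> R by rewrite ltr0n.
have h1 := @powRB_le k.+1%:R k%:R r k0 (ler0n _ _) r0 r1.
have h2 := @powRB_le k.+1%:R k.+2%:R r k0 (ler0n _ _) r0 r1.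
set A := k.+1%:R `^ r in h1 h2 *.
move: h1 h2; set X := A * (r * _); set Y := A * (r * _) => h1 h2.
have : X + Y = 0.
  rewrite /X /Y.
  have -> : k%:R = k.+1%:R - 1 :> R by rewrite -natr1 addrK.
  by rewrite -[k.+2%:R]natr1; field; rewrite gt_eqF.
clearbody X Y A; lra.
Qed.

Lemma expR_mid (a b c : R) : a + c <= 2 * b -> 2 * expR (- b) <= expR (- a) + expR (- c).
Proof.
move=> acb; have h : 2 * expR (- ((a + c) / 2)) <= expR (- a) + expR (- c).
  have -> : - a = - a / 2 + - a / 2 by field.
  have -> : - c = - c / 2 + - c / 2 by field.
  have -> : - ((a + c) / 2) = - a / 2 + - c / 2 by field.
  rewrite !expRD; set u := expR _; set v := expR _.
  have := sqr_ge0 (u - v); nra.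
apply: le_trans h; rewrite ler_pM2l// ler_expR; lra.
Qed.

Lemma expR1_le4 : expR 1 <= 4 :> R.
Proof.
have h : 1 / 2 <= expR (- (1 / 2)) :> R by have := @expR_ge1Dx R (- (1/2)); lra.
have h1 : expR (1 / 2) * expR (- (1 / 2)) = 1 :> R by rewrite -expRD subrr expR0.
have := expR_gt0 (1 / 2 : R); rewrite [in leLHS](splitr 1) expRD; nra.
Qed.

Lemma ln_ge1 x : 4 <= x -> 1 <= ln x.
Proof.
move=> x4; rewrite -[leLHS]expRK ler_ln ?posrE ?expR_gt0//; last by lra.
exact: le_trans expR1_le4 x4.
Qed.

End elementary.

(** * Decay and convexity of the normalized coefficients *)

Section coefficients.
Variables (R : realType) (alpha r : R) (n : nat).
Hypotheses (r_gt0 : 0 < r) (r_lt1 : r < 1) (alpha_gt0 : 0 < alpha).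
Hypotheses (n_gt0 : (0 < n)%N) (nstarP : nstar_ineq alpha r n).

Let nr_gt0 : 0 < n%:R :> R. Proof. by rewrite ltr0n. Qed.

(* The derivative of k |-> alpha k^r at k = n, that is the initial rate of decay of
   the normalized coefficients [coef]. *)
Definition decay : R := alpha * r / n%:R `^ (1 - r).

Definition coef (k : nat) : R := expR (alpha * n%:R `^ r - alpha * k%:R `^ r).

Lemma decay_gt0 : 0 < decay.
Proof. by rewrite /decay divr_gt0 ?mulr_gt0 ?powR_gt0. Qed.

Lemma decayMn : decay * n%:R = alpha * r * n%:R `^ r.
Proof.
have : n%:R `^ r * n%:R `^ (1 - r) = n%:R :> R.
  by rewrite -powRD; [rewrite (addrC r) subrK powRr1// ltW | rewrite lt0r_neq0 ?implybT].
rewrite /decay => {2}<-; field.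
by rewrite gt_eqF// powR_gt0.
Qed.

Lemma ln_pin_gt0 : 0 < ln (pi * n%:R : R).
Proof.
apply: ln_gt0; have := @pi_ge2 R; have : 1 <= n%:R :> R by rewrite ler1n.
nra.
Qed.

Lemma nstar_bound : 1 / (3 * pi) ^+ 3 <= 1 / 216 :> R.
Proof.
rewrite ler_pM2l// lef_pV2 ?posrE ?exprn_gt0 ?mulr_gt0 ?pi_gt0//.
have -> : 216 = 6 ^+ 3 :> R by ring.
rewrite lerXn2r ?nnegrE//; have := @pi_ge2 R; lra.
Qed.

Lemma decay_le : decay <= 1 / 216.
Proof.
apply: le_trans nstar_bound; apply: le_trans nstarP.
by rewrite lerDr divr_ge0 ?(ltW ln_pin_gt0)// !mulr_ge0 ?powR_ge0 ?ltW.
Qed.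

(** By [decayMn], the denominator in the first term of [nstar_ineq] is q n, so that this term, like
    q itself, is at most 1 / 216. *)
Lemma decayMn_ge : 216 * ln (pi * n%:R) <= decay * n%:R.
Proof.
have : ln (pi * n%:R) / (alpha * r * n%:R `^ r) <= 1 / 216.
  apply: le_trans nstar_bound; apply: le_trans nstarP.
  by rewrite lerDl ltW// decay_gt0.
rewrite -decayMn ler_pdivrMr ?(mulr_gt0 decay_gt0)//.
  lra.
Qed.

(** From ln 2 >= 1 / 2 one gets q n >= 108, and q <= 1 / 216 then gives n >= 108 * 216 = 23328. This
    rough size in turn yields ln (pi n) >= 1. *)
Lemma n_ge : 20000 <= n%:R :> R.
Proof.
have h1 := decayMn_ge; have h2 := decay_le; have h3 := decay_gt0.
have : 1 / 2 <= ln (pi * n%:R : R).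
  apply: le_trans (_ : ln 2 <= _); first by have := @ln_ge1BV R 2; lra.
  have := @pi_ge2 R; have : 1 <= n%:R :> R by rewrite ler1n.
  by move=> ? ?; rewrite ler_ln ?posrE//; nra.
nra.
Qed.

Lemma ln_pin_ge1 : 1 <= ln (pi * n%:R : R).
Proof. by apply: ln_ge1; have := n_ge; have := @pi_ge2 R; nra. Qed.

Lemma decayMn_ge216 : 216 <= decay * n%:R.
Proof. by have := decayMn_ge; have := ln_pin_ge1; lra. Qed.

Lemma coef_gt0 k : 0 < coef k.
Proof. exact: expR_gt0. Qed.

Lemma coef_n : coef n = 1.
Proof. by rewrite /coef subrr expR0. Qed.

Lemma coef_decr k : coef k.+1 <= coef k.
Proof.
rewrite ler_expR lerD2l lerN2 ler_pM2l//.
by rewrite ge0_ler_powR ?nnegrE ?ler_nat// ltW.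
Qed.

Lemma coef_convex k : 2 * coef k.+1 <= coef k + coef k.+2.
Proof.
have := @concave_powR_nat R k r r_gt0 r_lt1; rewrite -(ler_pM2l alpha_gt0) => h.
have := @expR_mid R (alpha * k%:R `^ r - alpha * n%:R `^ r)
  (alpha * k.+1%:R `^ r - alpha * n%:R `^ r) (alpha * k.+2%:R `^ r - alpha * n%:R `^ r).
rewrite !opprB; apply; lra.
Qed.

Lemma coef_first_diff : coef n - coef n.+1 <= decay.
Proof.
rewrite coef_n /coef.
have := @expR_ge1Dx R (alpha * n%:R `^ r - alpha * n.+1%:R `^ r).
have := @powRB_le R n%:R n.+1%:R r nr_gt0 (ler0n _ _) r_gt0 r_lt1.
rewrite -(ler_pM2l alpha_gt0).
have -> : alpha * (n%:R `^ r * (r * (n.+1%:R / n%:R - 1))) = decay.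
  rewrite -[RHS](mulfK (lt0r_neq0 nr_gt0)) decayMn -natr1; field.
  by rewrite gt_eqF.
lra.
Qed.

(** The bound is (k / n)^(- q n), a power with the large exponent q n. It comes from x^r >= 1 + r ln
    x. *)
Lemma coef_le_ln k : (0 < k)%N -> coef k <= expR (- (decay * n%:R * ln (k%:R / n%:R))).
Proof.
move=> k0; rewrite ler_expR lerNr opprB decayMn.
have := @powRB_ge R n%:R k%:R r nr_gt0; rewrite ltr0n => /(_ k0).
move=> /(ler_wpM2l (ltW alpha_gt0)).
set L := ln _; lra.
Qed.

(** Here ln (k / n) >= 1 / 2, and q n >= 216 ln (pi n) leaves ample room for 3 ln k. Of the three
    powers of k, one pays for the alias order and two make the tail summable. *)
Lemma coef_le_invX3 k : (2 * n <= k)%N -> coef k <= (k%:R ^+ 3)^-1.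
Proof.
move=> nk; have k0 : (0 < k)%N by lia.
have kr0 : 0 < k%:R :> R by rewrite ltr0n.
have kn2 : 2 <= k%:R / n%:R :> R by rewrite ler_pdivlMr// -natrM ler_nat.
apply: le_trans (coef_le_ln k0) _.
rewrite expRN lef_pV2 ?posrE ?expR_gt0 ?exprn_gt0//.
rewrite -[leLHS]lnK ?posrE ?exprn_gt0// ler_expR lnXn// -[leLHS]mulr_natl.
have lnk : ln k%:R = ln (k%:R / n%:R) + ln n%:R :> R.
  by rewrite ln_div ?posrE// subrK.
have l1 : 1 / 2 <= ln (k%:R / n%:R) :> R.
  have := @ln_ge1BV R (k%:R / n%:R); rewrite (lt_le_trans _ kn2)// => /(_ isT).
  have : (k%:R / n%:R)^-1 <= 1/2 :> R by rewrite div1r lef_pV2 ?posrE// (lt_le_trans _ kn2).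
  lra.
have l2 := ln_pin_ge1; have l3 := decayMn_ge.
have l4 : ln n%:R <= ln (pi * n%:R) :> R.
  by rewrite ler_ln ?posrE ?mulr_gt0 ?pi_gt0// ler_peMl// (le_trans _ (pi_ge2 _))// ler1n.
rewrite lnk; nra.
Qed.

(** Since ln (k / n) >= (k - n) / k and k <= 3n, a third of the initial rate q survives on the whole
    range. *)
Lemma coef_le_exp k : (n <= k)%N -> (k < 3 * n)%N ->
  coef k <= expR (- (decay / 3 * (k - n)%N%:R)).
Proof.
move=> nk k3n; have k0 : (0 < k)%N by lia.
have kr0 : 0 < k%:R :> R by rewrite ltr0n.
apply: le_trans (coef_le_ln k0) _; rewrite ler_expR lerN2.
have := @ln_ge1BV R (k%:R / n%:R) (divr_gt0 kr0 nr_gt0).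
rewrite invf_div => h.
have {h} : decay * n%:R * (1 - n%:R / k%:R) <= decay * n%:R * ln (k%:R / n%:R).
  by rewrite ler_pM2l// mulr_gt0// decay_gt0.
apply: le_trans.
have -> : decay * n%:R * (1 - n%:R / k%:R) = decay * (n%:R / k%:R) * (k - n)%N%:R.
  by rewrite natrB//; field; rewrite gt_eqF.
apply: ler_wpM2r => //; apply: ler_wpM2l; first exact: ltW decay_gt0.
rewrite ler_pdivlMr//.
have : k%:R <= 3 * n%:R :> R by rewrite -natrM ler_nat ltnW.
lra.
Qed.

(** Comparison with a geometric sum of ratio x = exp (- q / 3). From x <= 1 / (1 + q / 3) and q <= 1
    it follows that 1 - x >= q / 4. *)
Lemma sum_coef_le : \sum_(n <= k < (3 * n)%N.-1) coef k <= 4 / decay.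
Proof.
have q0 := decay_gt0; have q1 := decay_le.
pose x := expR (- (decay / 3)).
have x1 : x < 1 by rewrite expR_lt1; lra.
have x0 : 0 < x by exact: expR_gt0.
have hx : 1 - x >= decay / 4.
  have h : 1 + decay / 3 <= x^-1 by rewrite -expRN opprK; exact: expR_ge1Dx.
  have xV : x * x^-1 = 1 by rewrite divff// gt_eqF.
  nra.
apply: (@le_trans _ _ (\sum_(n <= k < (3 * n).-1) x ^+ (k - n))).
  apply: ler_sum_nat => k /andP[nk k3]; rewrite -expRM_natr mulNr; apply: coef_le_exp => //.
  lia.
rewrite -{1}(add0n n) big_addn.
under eq_bigr do rewrite addnK.
rewrite ler_pdivlMr//.
set m := (_ - n)%N.
have : (1 - x) * \sum_(0 <= i < m) x ^+ i = 1 - x ^+ m.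
  by rewrite big_mkord -opprB mulNr -subrX1 opprB.
have : 0 <= \sum_(0 <= i < m) x ^+ i by apply: sumr_ge0 => i _; rewrite exprn_ge0// ltW.
have : 0 <= x ^+ m by rewrite exprn_ge0// ltW.
nra.
Qed.

End coefficients.

(** The default value 0 of [xget] would be reached only if no n satisfied the inequality, so the
    content is the existence of one such n. *)
Lemma nstar_gt0 (R : realType) (alpha r : R) : 0 < r -> r < 1 -> 0 < alpha ->
  (0 < nstar alpha r)%N.
Proof.
move=> r0 r1 a0.
suff [n [n0 nP]] : exists n : nat, (0 < n)%N /\ nstar_ineq alpha r n.
  have exn : exists n, (0 < n)%N && `[< nstar_ineq alpha r n >].
    by exists n; rewrite n0; apply/asboolP.
  rewrite /nstar; case: xgetP => [m _ [] //|].
  case: (ex_minnP exn) => m /andP[m0 /asboolP mP] mmin /(_ m) [].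
  split => // k k0 kP; apply: mmin; rewrite k0; exact/asboolP.
have [e [e0 ele]] : exists e : R, 0 < e /\ e <= 1 / (3 * pi) ^+ 3.
  by exists (1 / (3 * pi) ^+ 3); rewrite divr_gt0 ?exprn_gt0 ?mulr_gt0 ?pi_gt0.
(* ln (pi n) <= (2 / r) (pi n) ^ (r / 2), so both terms tend to 0. *)
pose A := (2 / r * pi `^ (r / 2) / (alpha * r) * (2 / e)) `^ (2 / r).
pose B := (alpha * r * (2 / e)) `^ (1 - r)^-1.
(* A and B are the values of n at which the bounds of the two terms equal e / 2; exceeding A + B + 1
   passes both thresholds and keeps n positive. *)
have [n nAB] : exists n : nat, A + B + 1 < n%:R.
  by exists (Num.bound (A + B + 1)); apply: archi_boundP; rewrite ?addr_ge0 ?powR_ge0.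
have A0 : 0 <= A by exact: powR_ge0.
have B0 : 0 <= B by exact: powR_ge0.
have nr0 : 0 < n%:R :> R by lra.
exists n; split; first by rewrite -(ltr_nat R).
apply: le_trans ele; rewrite (splitr e); apply: lerD.
  have h : ln (pi * n%:R) <= 2 / r * (pi `^ (r / 2) * n%:R `^ (r / 2)).
    rewrite -powRM ?pi_ge0 ?(ltW nr0)//.
    have -> : ln (pi * n%:R) = 2 / r * ln ((pi * n%:R) `^ (r / 2)).
      by rewrite ln_powR; field; rewrite gt_eqF.
    rewrite ler_pM2l ?divr_gt0//; apply/ltW/ln_sublinear.
    by rewrite powR_gt0 ?mulr_gt0 ?pi_gt0.
  rewrite ler_pdivrMr ?mulr_gt0 ?powR_gt0//; apply: le_trans h _.
  have nn : n%:R `^ r = n%:R `^ (r / 2) * n%:R `^ (r / 2) :> R.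
    by rewrite -powRD ?gt_eqF ?implybT// -splitr.
  rewrite nn mulrA [leRHS]mulrA ![_ * (_ * n%:R `^ _)]mulrA.
  rewrite ler_pM2r ?powR_gt0//.
  have : A `^ (r / 2) <= n%:R `^ (r / 2).
    by rewrite ge0_ler_powR ?nnegrE//; lra.
  rewrite -powRrM.
  have -> : 2 / r * (r / 2) = 1 by field; rewrite gt_eqF.
  rewrite powRr1; last first.
    by rewrite !mulr_ge0 ?powR_ge0 ?invr_ge0 ?mulr_ge0 ?(ltW e0) ?(ltW r0) ?(ltW a0).
  have c0 : 0 < e / 2 * (alpha * r) by rewrite !mulr_gt0 ?invr_gt0.
  move=> /(ler_wpM2l (ltW c0)); apply: le_trans.
  by rewrite le_eqVlt; apply/orP; left; apply/eqP; field; rewrite !gt_eqF.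
rewrite ler_pdivrMr ?powR_gt0//.
have : B `^ (1 - r) <= n%:R `^ (1 - r) by rewrite ge0_ler_powR ?nnegrE//; lra.
rewrite -powRrM mulVf ?subr_eq0 ?gt_eqF// powRr1; last first.
  by rewrite !mulr_ge0 ?invr_ge0 ?(ltW e0) ?(ltW r0) ?(ltW a0).
have c0 : 0 < e / 2 by rewrite divr_gt0.
move=> /(ler_wpM2l (ltW c0)); apply: le_trans.
by rewrite le_eqVlt; apply/orP; left; apply/eqP; field; rewrite gt_eqF.
Qed.

(** * The main part of the error kernel *)

Section sine_bounds.
Variable R : realType.
Implicit Types x v : R.

(** The mean value theorem. The sign of the derivative is required on [0, +oo) only, so that each
    Taylor bound below feeds the next: sin, then cos, then sin again. *)
Lemma ge0_derive_ge0 (f df : R -> R) x : (forall y : R, is_derive y 1 f (df y)) ->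
  (forall y, 0 <= y -> 0 <= df y) -> f 0 = 0 -> 0 <= x -> 0 <= f x.
Proof.
move=> fdf df0 f0 x0.
have fc : continuous f.
  by move=> y; apply/differentiable_continuous/derivable1_diffP; have [] := fdf y.
have [c] := @MVT_segment R f df 0 x x0 (fun y _ => fdf y) (continuous_subspaceT fc).
rewrite in_itv /= f0 !subr0 => /andP[c0 _] ->.
by rewrite mulr_ge0// df0.
Qed.

Lemma sin_le x : 0 <= x -> sin x <= x.
Proof.
move=> x0; rewrite -subr_ge0.
apply: (@ge0_derive_ge0 (fun y => y - sin y) (fun y => 1 - cos y)) => //;
  last by rewrite sin0 subr0.
Qed.

Lemma cos_ge x : 0 <= x -> 1 - x ^+ 2 / 2 <= cos x.
Proof.
move=> x0; rewrite -subr_ge0.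
apply: (@ge0_derive_ge0 (fun y => cos y - (1 - y ^+ 2 / 2)) (fun y => y - sin y)) => //.
- move=> y; apply: is_derive_eq; rewrite !scaler1 /GRing.scale/=; by field.
- by move=> y y0; rewrite subr_ge0 sin_le.
- by rewrite cos0; field.
Qed.

Lemma sin_ge x : 0 <= x -> x - x ^+ 3 / 6 <= sin x.
Proof.
move=> x0; rewrite -subr_ge0.
apply: (@ge0_derive_ge0 (fun y => sin y - (y - y ^+ 3 / 6))
  (fun y => cos y - (1 - y ^+ 2 / 2))) => //.
- move=> y; apply: is_derive_eq; rewrite !scaler1 /GRing.scale/=; by field.
- by move=> y y0; rewrite subr_ge0 cos_ge.
- by rewrite sin0; field.
Qed.

Lemma pi_le4 : pi <= 4 :> R.
Proof. by have := @pihalf_lt2 R; lra. Qed.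

Lemma norm_2sin_half v : `|2 * sin (v / 2)| = `|2 * sin (`|v| / 2)|.
Proof.
have [v0|v0] := leP 0 v; first by rewrite (ger0_norm v0).
by rewrite (ltr0_norm v0) mulNr sinN mulrN normrN.
Qed.

(** For 0 <= u <= 4 one has u - u^3 / 24 >= u / 3. The range covers half a period since pi <= 4. *)
Lemma norm_2sin_half_ge v : `|v| <= 4 -> `|v| / 3 <= `|2 * sin (v / 2)|.
Proof.
rewrite norm_2sin_half; move: (normr_ge0 v); move: `|v| => u u0 u4.
have := @sin_ge (u / 2) (divr_ge0 u0 (ler0n _ 2)); have := ler_norm (2 * sin (u / 2)).
nra.
Qed.

(** The cosecant differs from 1 / |v| by a bounded amount, so the logarithm can be read off from
    harmonic sums. *)
Lemma inv_norm_2sin_half v : v != 0 -> `|v| <= 4 ->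
  `|v|^-1 <= `|2 * sin (v / 2)|^-1 <= `|v|^-1 + 1 / 2.
Proof.
move=> v0 v4; have := norm_2sin_half_ge v4; rewrite norm_2sin_half.
have : 0 < `|v| by rewrite normr_gt0.
move: v4; move: `|v| => u u4 u0 h.
have s0 : 0 < `|2 * sin (u / 2)| by apply: lt_le_trans h; rewrite divr_gt0.
have s1 := @sin_ge (u / 2) (divr_ge0 (ltW u0) (ler0n _ 2)).
have s2 := @sin_le (u / 2) (divr_ge0 (ltW u0) (ler0n _ 2)).
have sp : 0 <= sin (u / 2) by nra.
rewrite ger0_norm ?mulr_ge0// in s0 h *.
apply/andP; split; first by rewrite lef_pV2 ?posrE//; lra.
rewrite -div1r ler_pdivrMr// mulrDl -lerBlDr.
have uV : u^-1 * u = 1 by rewrite mulVf// gt_eqF.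
have uV0 : 0 < u^-1 by rewrite invr_gt0.
have -> : 1 - 1 / 2 * (2 * sin (u / 2)) = u^-1 * u - sin (u / 2) by rewrite uV; field.
move: (sin _) s1 s2 h => s s1 s2 h.
(* Here u / 2 - s <= u^3 / 48 <= u^2 s / 8, the last step because s >= u / 6. *)
have : u^-1 * (u / 2 - s) <= u^-1 * (u * u * s / 8 ) .
  rewrite ler_pM2l//; nra.
have -> : u^-1 * (u * u * s / 8) = u * s / 8 by rewrite -!mulrA mulKf ?gt_eqF.
have : u * s / 8 <= s / 2 by nra.
lra.
Qed.

End sine_bounds.

(** * Summation by parts for sine sums with convex coefficients *)

Section abel.
Variable R : realType.

Lemma abel_sum (b f : nat -> R) n m : (n <= m)%N ->
  \sum_(n <= k < m) b k * (f k - f k.+1) =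
  b n * f n - b m * f m - \sum_(n <= k < m) (b k - b k.+1) * f k.+1.
Proof.
elim: m => [|m IH]; first by rewrite leqn0 => /eqP ->; rewrite !big_geq//; ring.
rewrite leq_eqVlt => /orP[/eqP ->|]; first by rewrite !big_geq//; ring.
by rewrite ltnS => nm; rewrite !big_nat_recr//= IH//; ring.
Qed.

(** The boundary terms are at most d_n and d_m, and the total variation of d is d_n - d_m: together
    2 d_n. *)
Lemma norm_abel_le (d f : nat -> R) n m : (n <= m)%N ->
  (forall k, 0 <= d k) -> (forall k, d k.+1 <= d k) -> (forall k, `|f k| <= 1) ->
  `|\sum_(n <= k < m) d k * (f k - f k.+1)| <= 2 * d n.
Proof.
move=> nm d0 dd f1; rewrite abel_sum//.
have h k : `|d k * f k| <= d k.
  by rewrite normrM ger0_norm// ler_piMr.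
have hs : `|\sum_(n <= k < m) (d k - d k.+1) * f k.+1| <= d n - d m.
  rewrite -[leRHS]opprB -telescope_sumr// -sumrN (le_trans (ler_norm_sum _ _ _))//.
  apply: ler_sum => k _; rewrite opprB normrM ger0_norm ?subr_ge0//.
  by rewrite ler_piMr ?subr_ge0.
apply: le_trans (ler_normB _ _) _.
have := ler_normB (d n * f n) (d m * f m); have := h n; have := h m; lra.
Qed.

Definition sin_sum (b : nat -> R) (n m : nat) (xi u : R) : R :=
  \sum_(n <= k < m) b k * sin (k%:R * u + xi).

(** Times 2 sin (u / 2), each sine is a difference of consecutive cosines; the boundary term at n is
    the main term and the one at m goes into the error. The remaining sum has coefficients b_k -
    b_(k+1). *)
Lemma sin_sum_approx (b : nat -> R) n m xi u : (n <= m)%N ->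
  (forall k, 0 <= b k) -> (forall k, b k.+1 <= b k) ->
  (forall k, 2 * b k.+1 <= b k + b k.+2) -> sin (u / 2) != 0 ->
  `|sin_sum b n m xi u - b n * cos (n%:R * u + xi - u / 2) / (2 * sin (u / 2))| <=
  2 * (b n - b n.+1) / `|2 * sin (u / 2)| ^+ 2 + b m / `|2 * sin (u / 2)|.
Proof.
move=> nm b0 bd bc su0; set D := 2 * sin (u / 2).
have D0 : D != 0 by rewrite /D mulf_neq0.
have Dn0 : 0 < `|D| by rewrite normr_gt0.
pose C k := cos (k%:R * u + xi - u / 2).
have C1 : forall k, `|C k| <= 1 by move=> k; exact: cos_max.
have E1 : D * sin_sum b n m xi u = b n * C n - b m * C m -
    \sum_(n <= k < m) (b k - b k.+1) * C k.+1.
  rewrite -abel_sum// /sin_sum mulr_sumr; apply: eq_bigr => k _.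
  rewrite mulrCA sin_mul_sin2; congr (_ * (_ - _)).
  by rewrite /C -natr1; congr cos; field.
(* Second summation by parts: the cosines become differences of sines, and convexity makes b_k -
   b_(k+1) decreasing, as [norm_abel_le] requires. *)
have E2 : `|D * \sum_(n <= k < m) (b k - b k.+1) * C k.+1| <= 2 * (b n - b n.+1).
  pose s k := sin (k%:R * u + xi).
  have -> : D * (\sum_(n <= k < m) (b k - b k.+1) * C k.+1) =
      - \sum_(n <= k < m) (b k - b k.+1) * (s k - s k.+1).
    rewrite mulr_sumr -sumrN; apply: eq_bigr => k _.
    rewrite mulrCA sin_mul_cos2 -[RHS]mulrN opprB; congr (_ * (_ - _)).
      by rewrite /s /C; congr sin; rewrite -natr1; field.
    by rewrite /s /C; congr sin; rewrite -natr1; field.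
  rewrite normrN; apply: (@norm_abel_le (fun k => b k - b k.+1)) => //.
  - by move=> k; rewrite subr_ge0.
  - by move=> k; have := bc k; lra.
  - by move=> k; exact: sin_max.
set T := \sum_(n <= k < m) _ in E1 E2.
clearbody D.
have -> : sin_sum b n m xi u - b n * C n / D = - (b m * C m / D) - (D * T) / D ^+ 2.
  apply: (mulfI D0); rewrite mulrBr E1; field; exact: D0.
apply: le_trans (ler_normB _ _) _; rewrite addrC lerD//.
  by rewrite normrM normfV normrX ler_pM2r ?invr_gt0 ?exprn_gt0.
rewrite normrN !normrM normfV ler_pM2r ?invr_gt0// ger0_norm//.
by rewrite ler_piMr.
Qed.

End abel.

(** * Comparison of harmonic sums with logarithms *)

Section harmonic.
Variable R : realType.

(** Each term satisfies 1 / k <= ln (k / (k - 1)), hence the shift by one at both ends. *)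
Lemma sum_inv_le_ln (a m : nat) : (1 < a)%N -> (a <= m)%N ->
  \sum_(a <= k < m) (k%:R)^-1 <= ln (m.-1%:R / a.-1%:R : R).
Proof.
move=> a1; elim: m => [|m IH]; first by rewrite leqn0 => /eqP a0; move: a1; rewrite a0.
rewrite leq_eqVlt => /orP[/eqP <-|]; rewrite /=.
  by rewrite big_geq// divff ?ln1// pnatr_eq0; lia.
rewrite ltnS => am; rewrite big_nat_recr//=.
apply: (@le_trans _ _ (ln (m.-1%:R / a.-1%:R) + m%:R^-1)); first by rewrite lerD2r IH.
have a0 : 0 < a.-1%:R :> R by rewrite ltr0n; lia.
have m0 : 0 < m%:R :> R by rewrite ltr0n; lia.
have m1 : 0 < m.-1%:R :> R by rewrite ltr0n; lia.
rewrite !ln_div ?posrE// addrAC lerD2r addrC -lerBrDr -ln_div ?posrE//.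
apply: le_trans (ln_ge1BV _); last exact: divr_gt0.
rewrite invf_div; have -> : m.-1%:R = m%:R - 1 :> R by rewrite -subn1 natrB//; lia.
by rewrite le_eqVlt; apply/orP; left; apply/eqP; field; rewrite gt_eqF.
Qed.

Lemma sum_inv_ge_ln (a m : nat) : (0 < a)%N -> (a <= m)%N ->
  ln (m%:R / a%:R : R) <= \sum_(a <= k < m) (k%:R)^-1.
Proof.
move=> a0; have ar0 : 0 < a%:R :> R by rewrite ltr0n.
elim: m => [|m IH]; first by rewrite leqn0 => /eqP a0'; move: a0; rewrite a0'.
rewrite leq_eqVlt => /orP[/eqP <-|]; first by rewrite big_geq// divff ?ln1// gt_eqF.
rewrite ltnS => am; rewrite big_nat_recr//=.
have m0 : 0 < m%:R :> R by rewrite ltr0n; lia.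
apply: (@le_trans _ _ (ln (m%:R / a%:R) + m%:R^-1)); last by rewrite lerD2r IH.
have m1 : 0 < m.+1%:R :> R by rewrite ltr0n.
rewrite !ln_div ?posrE// addrAC lerD2r addrC -lerBlDr -ln_div ?posrE//.
apply: le_trans (ln_leB1 _) _; first exact: divr_gt0.
rewrite -natr1.
by rewrite le_eqVlt; apply/orP; left; apply/eqP; field; rewrite gt_eqF.
Qed.

Lemma sum_inv_sq_le (a m : nat) : (1 < a)%N -> (a <= m)%N ->
  \sum_(a <= k < m) (k%:R ^+ 2)^-1 <= (a.-1%:R)^-1 - (m.-1%:R)^-1 :> R.
Proof.
move=> a1; elim: m => [|m IH]; first by rewrite leqn0 => /eqP a0; move: a1; rewrite a0.
rewrite leq_eqVlt => /orP[/eqP <-|]; rewrite /=; first by rewrite big_geq// subrr.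
rewrite ltnS => am; rewrite big_nat_recr//=.
apply: (@le_trans _ _ ((a.-1%:R)^-1 - (m.-1%:R)^-1 + (m%:R ^+ 2)^-1)).
  by rewrite lerD2r IH.
rewrite -addrA lerD2l -subr_ge0.
have m0 : 0 < m%:R :> R by rewrite ltr0n; lia.
have m1 : 0 < m.-1%:R :> R by rewrite ltr0n; lia.
have E : m.-1%:R = m%:R - 1 :> R by rewrite -subn1 natrB//; lia.
rewrite E in m1 *.
have -> : - m%:R^-1 - (- (m%:R - 1)^-1 + (m%:R ^+ 2)^-1) =
  (m%:R ^+ 2 * (m%:R - 1))^-1 :> R.
  by field; rewrite !gt_eqF.
by rewrite invr_ge0 mulr_ge0 ?exprn_ge0 ?ltW.
Qed.

End harmonic.

(** * Sums over the translates of a point by multiples of h *)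

Lemma sum_symmetric (R : realType) (g : R -> R) (p : nat) :
  \sum_(i < p.*2.+1) g (i%:R - p%:R) =
  g 0 + \sum_(1 <= i < p.+1) (g i%:R + g (- i%:R)).
Proof.
elim: p => [|p IH].
  by rewrite big_ord_recl big_ord0 big_geq// subrr !addr0.
rewrite doubleS big_ord_recl big_ord_recr/= big_nat_recr//= [RHS]addrA -IH.
rewrite (_ : (p.*2.+2)%:R - p.+1%:R = p.+1%:R :> R); last first.
  by rewrite -addnn -!natr1 natrD; ring.
rewrite sub0r [LHS]addrCA; congr (_ + _); last by rewrite addrC.
by apply: eq_bigr => i _; congr g; rewrite /bump/= add1n -!natr1; ring.
Qed.

(** The distance |u| is within h / 2 of i h; it is rounded to integer multiples of h so that
    harmonic sums with shifted index appear. The bound 4 comes from p h + h / 2 = pi. *)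
Lemma lattice_dist (R : realType) (s h i p u : R) :
  0 < h -> `|s| <= h / 2 -> 2 <= i -> i <= p ->
  h * (2 * p + 1) = 2 * pi -> pi <= (4 : R) -> u = s + i * h \/ u = s + (- i) * h ->
  [/\ (i - 1) * h <= `|u|, `|u| <= (i + 1) * h & `|u| <= 4].
Proof.
move=> h0; rewrite ler_norml => /andP[s1 s2] i2 ip hn pi4 ue.
have h2i : 2 * h <= i * h by rewrite ler_pM2r.
have hip : i * h <= p * h by rewrite ler_pM2r.
have {ue} : `|u| = s + i * h \/ `|u| = - s + i * h.
  case: ue => ->; [left; rewrite ger0_norm|right; rewrite ler0_norm]; lra.
by case=> ->; split; lra.
Qed.

(** J counts the steps up to distance about q from 0. The first bound uses (p - 1) h <= 4 and ln 4
    <= 3; the second uses J + 2 <= q (p + 2), for which q (p + 1) >= 216 is needed. The last is the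
    cost of the 2 J + 1 central points, each bounded by 4 / q. *)
Lemma lattice_sum_bounds (R : realType) (q h : R) (p J : nat) :
  0 < q -> q <= 1 / 216 -> 216 <= q * (p%:R + 1) -> 0 < h ->
  h * (2 * p%:R + 1) = 2 * pi -> q / h <= J%:R - 1 -> J%:R <= q / h + 2 ->
  27 <= q / h -> (J < p)%N -> (1 < J)%N ->
  [/\ \sum_(J <= k < p) (k%:R)^-1 <= 3 + ln q^-1,
      ln q^-1 <= \sum_(J.+2 <= k < p.+2) (k%:R)^-1,
      q / h * \sum_(J <= k < p) (k%:R ^+ 2)^-1 <= 1,
      0 <= 2 * (p - J)%N%:R * h <= 8
    & h * ((2 * J%:R + 1) * (4 / q)) <= 10].
Proof.
move=> q_gt0 q_le qn_ge h_gt0 hn J1 J2 qh_ge Jp J1'.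
have pi2 := pi_ge2 R; have pi4 := pi_le4 R; have p0 := ler0n R p.
have JE : J.-1%:R = J%:R - 1 :> R.
  by rewrite -[in RHS](@prednK J) -?natr1 ?addrK//; exact: ltnW.
have pE : p.-1%:R = p%:R - 1 :> R.
  by rewrite -[in RHS](@prednK p) -?natr1 ?addrK//; move: Jp; clear; lia.
have Jm0 : 0 < J%:R - 1 :> R by move: qh_ge J1; clear; lra.
have qhE : q / h * h = q by rewrite divfK// gt_eqF.
have qJ : q <= (J%:R - 1) * h by rewrite -ler_pdivrMr.
split.
- apply: le_trans (sum_inv_le_ln _ J1' (ltnW Jp)) _; rewrite JE pE.
  apply: (@le_trans _ _ (ln (4 * q^-1))).
    have pm0 : 0 < p%:R - 1 :> R by rewrite subr_gt0 ltr1n (ltn_trans J1').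
    rewrite ler_ln ?posrE ?mulr_gt0 ?divr_gt0 ?invr_gt0//.
    rewrite ler_pdivrMr// mulrAC ler_pdivlMr//.
    have ph : (p%:R - 1) * h <= 4 by move: hn pi4 h_gt0; clear; lra.
    apply: (@le_trans _ _ ((p%:R - 1) * ((J%:R - 1) * h))).
      by rewrite ler_pM2l.
    by rewrite mulrCA mulrC ler_pM2r.
  rewrite lnM ?posrE ?invr_gt0// lerD2r.
  by have := @ln_leB1 R 4; clear; lra.
- apply: le_trans (@sum_inv_ge_ln R J.+2 p.+2 _ _) => //; last by rewrite !ltnS ltnW.
  rewrite ler_ln ?posrE ?divr_gt0 ?invr_gt0 ?ltr0n//.
  rewrite ler_pdivlMr ?ltr0n// mulrC ler_pdivrMr//.
  have : q / h <= q * (2 * p%:R + 1) / 4.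
    rewrite -mulrA ler_pM2l// -div1r ler_pdivrMr// mulrAC (mulrC _ h) hn.
    by move: pi2; clear; lra.
  rewrite -[J.+2%:R]natr1 -[J.+1%:R]natr1 -[p.+2%:R]natr1 -[p.+1%:R]natr1.
  by move: qn_ge J2 q_gt0; clear; lra.
- have := @sum_inv_sq_le R J p J1' (ltnW Jp); rewrite JE; set S2 := \sum_(_ <= _ < _) _.
  have pV : 0 <= (p.-1%:R)^-1 :> R by rewrite invr_ge0.
  move=> HS; apply: (@le_trans _ _ (q / h * (J%:R - 1)^-1)).
    rewrite ler_pM2l ?divr_gt0//.
    by move: pV HS; clear; lra.
  by rewrite ler_pdivrMr// mul1r.
- have pJ0 : 0 <= (p - J)%N%:R :> R by [].
  have pJp : (p - J)%N%:R <= p%:R :> R by rewrite ler_nat leq_subr.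
  rewrite !mulr_ge0 ?(ltW h_gt0)//=.
  apply: (@le_trans _ _ (2 * p%:R * h)); first by rewrite ler_pM2r// ler_pM2l.
  by move: hn pi4 h_gt0; clear; lra.
- have -> : h * ((2 * J%:R + 1) * (4 / q)) = (2 * J%:R + 1) * h * 4 / q by ring.
  rewrite ler_pdivrMr//.
  have : (2 * J%:R + 1) * h <= 5 / 2 * q.
    by rewrite -[X in _ <= _ * X]qhE mulrA ler_pM2r//; move: J2 qh_ge; clear; lra.
  by clear; lra.
Qed.

(** The constant is 60 = 10 + 6 + 36 + 8: the central points, the 3 in the bound of the harmonic sum
    (twice), the quadratic errors 18 q / u^2 on both sides, and the unit errors of the far
    points. *)
Lemma lattice_sum_approx (R : realType) (G L : R -> R) (q h : R) (p : nat) (s : R) :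
  0 < q -> q <= 1 / 216 -> 216 <= q * (p%:R + 1) -> 0 < h ->
  h * (2 * p%:R + 1) = 2 * pi -> 19999 <= p%:R :> R ->
  (forall u, `|G u| <= 4 / q) -> (forall u, `|L u| <= 1) ->
  (forall u (i : nat), `|L (u + i%:R * h)| = `|L u|) ->
  (forall u (i : nat), (1 < i)%N -> (i%:R - 1) * h <= `|u| ->
     `|u| <= (i%:R + 1) * h -> `|u| <= 4 ->
     `|G u| <= `|L u| / h / (i%:R - 1) + 18 * q / h ^+ 2 / (i%:R - 1) ^+ 2 + 1) ->
  (forall u (i : nat), (1 < i)%N -> (i%:R - 1) * h <= `|u| ->
     `|u| <= (i%:R + 1) * h -> `|u| <= 4 ->
     `|L u| / h / (i%:R + 1) - 18 * q / h ^+ 2 / (i%:R - 1) ^+ 2 - 1 <= `|G u|) ->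
  `|s| <= h / 2 ->
  `|h * (\sum_(i < p.*2.+1) `|G (s + (i%:R - p%:R) * h)|) - 2 * `|L s| * ln q^-1| <= 60.
Proof.
move=> q_gt0 q_le qn_ge h_gt0 hn p_big Gle Lle Lshift far_le far_ge sh.
set CS := \sum_(i < p.*2.+1) _.
pose J := (Num.truncn (q / h)).+2.
have qh0 : 0 < q / h by rewrite divr_gt0.
have [J1 J2] : q / h <= J%:R - 1 /\ J%:R <= q / h + 2.
  have /andP[] := truncn_itv (ltW qh0); by rewrite /J -!natr1; clear; split; lra.
have pi2 := pi_ge2 R; have pi4 := pi_le4 R.
have qhE : q / h * h = q by rewrite divfK// gt_eqF.
have qh_ge : 27 <= q / h.
  rewrite ler_pdivlMr//;   have p0 := ler0n R p.
  have : 27 * (h * (2 * p%:R + 1)) <= q * (2 * p%:R + 1).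
    by rewrite hn; move: pi4 qn_ge p0 q_gt0; clear; nra.
  by rewrite mulrA ler_pM2r//; move: p0; clear; lra.
have Jp : (J < p)%N.
  rewrite -(ltr_nat R); apply: le_lt_trans J2 _.
  have : q / h <= (2 * p%:R + 1) / 864.
    by rewrite ler_pdivrMr// mulrC mulrA hn; move: q_le pi2; clear; lra.
  by move: p_big; clear; lra.
have L1 := Lle s.
have L0 : 0 <= `|L s| by [].
have far (i : nat) : (J < i)%N -> (i <= p)%N -> forall u,
   (u = s + i%:R * h) \/ (u = s + (- i%:R) * h) ->
  [/\ (i%:R - 1) * h <= `|u|, `|u| <= (i%:R + 1) * h, `|u| <= 4 & `|L u| = `|L s|].
  move=> Ji ip u ue.
  have i0 : 2 <= i%:R :> R by rewrite ler_nat; move: Ji; rewrite /J; clear; lia.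
  have ip' : i%:R <= p%:R :> R by rewrite ler_nat.
  have [u1 u2 u3] := lattice_dist h_gt0 sh i0 ip' hn pi4 ue.
  split=> //.
  case: ue => ->; first exact: Lshift.
  by rewrite -(Lshift _ i); congr `|L _|; ring.
have J0 : (0 < J)%N by [].
pose X (i : nat) : R := 18 * q / h ^+ 2 / (i%:R - 1) ^+ 2.
have up : h * CS <= h * ((2 * J%:R + 1) * (4 / q)) +
    h * \sum_(J.+1 <= i < p.+1) 2 * (`|L s| / h / (i%:R - 1) + X i + 1).
  rewrite -mulrDr ler_pM2l// /CS (sum_symmetric (fun v => `|G (s + v * h)|)).
  rewrite (big_cat_nat (m := 1) (n := J.+1))//=; last by move: Jp; clear; lia.
  rewrite addrA; apply: lerD.
    apply: (@le_trans _ _ (4 / q + \sum_(1 <= i < J.+1) (4 / q + 4 / q))).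
      by apply: lerD; [|apply: ler_sum => i _; apply: lerD]; exact: Gle.
    rewrite sumr_const_nat subSS subn0 -[_ *+ J]mulr_natl.
    by rewrite le_eqVlt; apply/orP; left; apply/eqP; ring.
  apply: ler_sum_nat => i /andP[Ji ip].
  have i1 : (1 < i)%N by move: Ji; rewrite /J; clear; lia.
  have [a1 a2 a3 a4] := far i Ji ip _ (or_introl erefl).
  have [b1 b2 b3 b4] := far i Ji ip _ (or_intror erefl).
  have := far_le _ _ i1 a1 a2 a3; have := far_le _ _ i1 b1 b2 b3.
  by rewrite a4 b4 -/(X i); clear; lra.
(* For the lower bound the central terms are dropped, being nonnegative. *)
have lo : h * \sum_(J.+1 <= i < p.+1) 2 * (`|L s| / h / (i%:R + 1) - X i - 1)
    <= h * CS.
  rewrite ler_pM2l// /CS (sum_symmetric (fun v => `|G (s + v * h)|)).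
  rewrite (big_cat_nat (m := 1) (n := J.+1))//=; last by move: Jp; clear; lia.
  rewrite addrA -[leLHS]add0r; apply: lerD.
    by rewrite addr_ge0// sumr_ge0// => i _; rewrite addr_ge0.
  apply: ler_sum_nat => i /andP[Ji ip].
  have i1 : (1 < i)%N by move: Ji; rewrite /J; clear; lia.
  have [a1 a2 a3 a4] := far i Ji ip _ (or_introl erefl).
  have [b1 b2 b3 b4] := far i Ji ip _ (or_intror erefl).
  have := far_ge _ _ i1 a1 a2 a3; have := far_ge _ _ i1 b1 b2 b3.
  by rewrite a4 b4 -/(X i); clear; lra.
pose S1 : R := \sum_(J <= k < p) (k%:R)^-1.
pose S2 : R := \sum_(J <= k < p) (k%:R ^+ 2)^-1.
pose S3 : R := \sum_(J.+2 <= k < p.+2) (k%:R)^-1.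
have upE : h * (\sum_(J.+1 <= i < p.+1) 2 * (`|L s| / h / (i%:R - 1) + X i + 1)) =
   2 * `|L s| * S1 + 36 * (q / h) * S2 + 2 * (p - J)%N%:R * h.
  rewrite big_add1/= /S1 /S2 !mulr_sumr.
  have -> : 2 * (p - J)%N%:R * h = \sum_(J <= i < p) (2 * h).
    by rewrite sumr_const_nat -[RHS]mulr_natl; ring.
  rewrite -!big_split/=; apply: eq_big_nat => i /andP[Ji _].
  have i0 : i%:R != 0 :> R by rewrite pnatr_eq0; move: Ji; rewrite /J; clear; lia.
  rewrite /X -[i.+1%:R]natr1 addrK; field.
  by rewrite i0 gt_eqF.
have loE : h * (\sum_(J.+1 <= i < p.+1) 2 * (`|L s| / h / (i%:R + 1) - X i - 1)) =
   2 * `|L s| * S3 - 36 * (q / h) * S2 - 2 * (p - J)%N%:R * h.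
  have -> : S3 = \sum_(J <= k < p) (k.+2%:R)^-1 by rewrite /S3 2!big_add1.
  rewrite big_add1/= /S2 !mulr_sumr.
  have -> : 2 * (p - J)%N%:R * h = \sum_(J <= i < p) (2 * h).
    by rewrite sumr_const_nat -[RHS]mulr_natl; ring.
  rewrite -!sumrB/=; apply: eq_big_nat => i /andP[Ji _].
  have i0 : i%:R != 0 :> R by rewrite pnatr_eq0; move: Ji; rewrite /J; clear; lia.
  have i2 : i%:R + 1 + 1 != 0 :> R by rewrite !natr1 pnatr_eq0.
  rewrite /X -[i.+2%:R]natr1 -[i.+1%:R]natr1 addrK; field.
  by rewrite i0 i2 gt_eqF.
have [S1le S3ge hS2 /andP[hp0 hp] hJ] :=
  lattice_sum_bounds q_gt0 q_le qn_ge h_gt0 hn J1 J2 qh_ge Jp isT.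
rewrite -/S1 -/S2 -/S3 in S1le S3ge hS2.
have lS3 : `|L s| * ln q^-1 <= `|L s| * S3 by rewrite ler_wpM2l.
have lS1 : `|L s| * S1 <= `|L s| * (3 + ln q^-1) by rewrite ler_wpM2l.
rewrite ler_norml; apply/andP; split.
  by move: lo; rewrite loE; clear upE loE up;
    move: S3 S2 S3ge hS2 lS3 hp0 hp; clear => S3 S2; lra.
move: up; rewrite upE; clear loE upE lo.
move: S1 S2 S1le hS2 lS1 hp0 hp hJ L1; clear => S1 S2; lra.
Qed.


Lemma kernel_upper_arith (R : realType) (g t e a x l : R) :
  g - t <= e -> t <= l -> l <= a + 1 / 2 -> e <= x + 1 / 2 -> g <= a + x + 1.
Proof. lra. Qed.

(** * Pointwise estimates of G and its sums over cosets *)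

Section kernel.
Variables (R : realType) (alpha r xi : R) (p : nat).
Let n := p.+1.
Let N := p.*2.+1.
Hypotheses (r_gt0 : 0 < r) (r_lt1 : r < 1) (alpha_gt0 : 0 < alpha).
Hypothesis nstarP : nstar_ineq alpha r n.

Let q := decay alpha r n.
Let b := coef alpha r n.

Definition step : R := 2 * pi / N%:R.
Let h := step.

Definition main_kernel (u : R) : R := sin_sum b n (3 * n)%N.-1 xi u.
Let G := main_kernel.

Definition carrier (u : R) : R := cos (N%:R / 2 * u + xi).
Let L := carrier.

Let n_gt0 : (0 < n)%N. Proof. by []. Qed.
Let q_gt0 : 0 < q. Proof. exact: decay_gt0. Qed.
Let q_le : q <= 1 / 216. Proof. exact: decay_le nstarP. Qed.
Let qn_ge : 216 <= q * n%:R. Proof. exact: decayMn_ge216 nstarP. Qed.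
Let N_gt0 : 0 < N%:R :> R. Proof. by rewrite ltr0n. Qed.
Let NE : N%:R = 2 * p%:R + 1 :> R. Proof. by rewrite /N natN_half. Qed.
Let nE : n%:R = p%:R + 1 :> R. Proof. by rewrite /n natr1. Qed.
Let hN : h * N%:R = 2 * pi. Proof. by rewrite /h /step mulfVK ?gt_eqF. Qed.

Lemma step_gt0 : 0 < h.
Proof. by rewrite /h /step divr_gt0// mulr_gt0 ?pi_gt0. Qed.
Let h_gt0 := step_gt0.

Lemma main_kernel_le u : `|G u| <= 4 / q.
Proof.
apply: le_trans (sum_coef_le r_gt0 r_lt1 alpha_gt0 n_gt0 nstarP).
apply: le_trans (ler_norm_sum _ _ _) _; apply: ler_sum => k _.
rewrite normrM ger0_norm ?(ltW (coef_gt0 _ _ _ _))//.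
by rewrite ler_piMr ?sin_max// ltW// coef_gt0.
Qed.

(** With 1 / |2 sin (u / 2)| <= 3 / |u|, the second-order term 2 (b_n - b_(n+1)) becomes 18 q / u^2,
    where 18 = 2 * 3^2. The upper boundary coefficient b_(3n-1) is at most n^-3. *)
Lemma main_kernel_approx u : u != 0 -> `|u| <= 4 ->
  `| `|G u| - `|L u| / `|2 * sin (u / 2)| | <= 18 * q / `|u| ^+ 2 + 3 / n%:R ^+ 3 / `|u|.
Proof.
move=> u0 u4; have un0 : 0 < `|u| by rewrite normr_gt0.
have D3 := norm_2sin_half_ge u4.
have D0 : 0 < `|2 * sin (u / 2)| by apply: lt_le_trans D3; rewrite divr_gt0.
have s0 : sin (u / 2) != 0.
  by apply: contraTneq D0 => ->; rewrite mulr0 normr0 ltxx.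
have := @sin_sum_approx R b n (3 * n)%N.-1 xi u _ _ _ _ s0.
rewrite (_ : n%:R * u + xi - u / 2 = N%:R / 2 * u + xi); last first.
  by rewrite NE nE; field.
rewrite (_ : b n * cos (N%:R / 2 * u + xi) = L u); last by rewrite /b coef_n mul1r.
rewrite -/(G u) => H.
rewrite -normf_div; apply: le_trans (ler_dist_dist _ _) _; apply: le_trans (H _ _ _ _) _.
- by clear; rewrite /n; lia.
- by move=> k; rewrite ltW// coef_gt0.
- by move=> k; exact: coef_decr.
- by move=> k; exact: coef_convex.
have D3' : `|2 * sin (u / 2)|^-1 <= 3 / `|u|.
  by rewrite -[leRHS]invf_div lef_pV2 ?posrE// divr_gt0.
have bm : b (3 * n)%N.-1 <= (n%:R ^+ 3)^-1.
  apply: le_trans (coef_le_invX3 r_gt0 r_lt1 alpha_gt0 n_gt0 nstarP _) _.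
    by clear; rewrite /n; lia.
  rewrite lef_pV2 ?posrE ?exprn_gt0 ?ltr0n//; last by clear; rewrite /n; lia.
  by rewrite lerXn2r ?nnegrE// ler_nat; clear; rewrite /n; lia.
have d0 : b n - b n.+1 <= q by exact: coef_first_diff.
have DV0 : 0 < `|2 * sin (u / 2)|^-1 by rewrite invr_gt0.
apply: lerD.
  rewrite -exprVn -[`|u| ^- 2]exprVn.
  have -> : 18 * q * `|u|^-1 ^+ 2 = 2 * q * (3 / `|u|) ^+ 2 by ring.
  apply: ler_pM.
  - by rewrite mulr_ge0// subr_ge0 coef_decr.
  - by rewrite exprn_ge0// ltW.
  - by rewrite ler_pM2l.
  - by rewrite lerXn2r ?nnegrE ?divr_ge0// ltW.
rewrite mulrAC mulrC; apply: ler_pM => //.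
by rewrite ltW// coef_gt0.
Qed.

Section far.
Variables (u : R) (i : nat).
Hypotheses (i_gt1 : (1 < i)%N) (u_ge : (i%:R - 1) * h <= `|u|)
  (u_le : `|u| <= (i%:R + 1) * h) (u4 : `|u| <= 4).

Let w_gt0 : 0 < (i%:R - 1) * h.
Proof. by rewrite mulr_gt0// subr_gt0 ltr1n. Qed.

Let u_gt0 : 0 < `|u|. Proof. exact: lt_le_trans u_ge. Qed.

Let u_neq0 : u != 0. Proof. by rewrite -normr_gt0. Qed.

Let err_le : 18 * q / `|u| ^+ 2 + 3 / n%:R ^+ 3 / `|u| <=
  18 * q / h ^+ 2 / (i%:R - 1) ^+ 2 + 1 / 2.
Proof.
apply: lerD.
  have -> : 18 * q / h ^+ 2 / (i%:R - 1) ^+ 2 = 18 * q / ((i%:R - 1) * h) ^+ 2.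
    by field; rewrite gt_eqF//= subr_eq0 pnatr_eq1 gtn_eqF.
  apply: ler_wpM2l; first by rewrite mulr_ge0// ltW.
  rewrite lef_pV2 ?posrE ?exprn_gt0//.
  by rewrite lerXn2r ?nnegrE// ltW.
(* In fact h n > pi. Hence 1 / |u| <= 1 / h <= n, and the boundary term is at most 3 / n^2. *)
have hn : 1 <= h * n%:R.
  have n_big : 20000 <= n%:R :> R by exact: n_ge nstarP.
  move: n_big; have := pi_ge2 R; rewrite nE; move: hN; rewrite NE => E ? ?.
  have := h_gt0; nra.
have n0 : 0 < n%:R :> R by rewrite ltr0n.
have uV : `|u|^-1 <= n%:R.
  rewrite -[leRHS]invrK lef_pV2 ?posrE ?invr_gt0//.
  apply: le_trans u_ge; rewrite -div1r ler_pdivrMr// -mulrA.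
  have i1 : 1 <= i%:R - 1 :> R by rewrite lerBrDr (ler_nat _ 2).
  by apply: le_trans hn _; rewrite ler_peMl// mulr_ge0// ltW.
apply: le_trans (_ : 3 / n%:R ^+ 3 * n%:R <= _).
  by rewrite ler_pM2l// divr_gt0// exprn_gt0.
have -> : 3 / n%:R ^+ 3 * n%:R = 3 / (n%:R * n%:R) :> R by field; rewrite gt_eqF.
have n_big : 20000 <= n%:R :> R by exact: n_ge nstarP.
by rewrite ler_pdivrMr ?mulr_gt0//; nra.
Qed.

Let L1 : `|L u| <= 1. Proof. exact: cos_max. Qed.

(** The final 1 is 1 / 2 for replacing the cosecant and 1 / 2 for the boundary term in [err_le]. *)
Lemma main_kernel_far_le :
  `|G u| <= `|L u| / h / (i%:R - 1) + 18 * q / h ^+ 2 / (i%:R - 1) ^+ 2 + 1.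
Proof.
have := main_kernel_approx u_neq0 u4; rewrite ler_norml => /andP[_ H].
have /andP[_ S] := inv_norm_2sin_half u_neq0 u4.
have uV : `|u|^-1 <= ((i%:R - 1) * h)^-1 by rewrite lef_pV2 ?posrE.
have : `|L u| / `|2 * sin (u / 2)| <= `|L u| * (((i%:R - 1) * h)^-1 + 1 / 2).
  by rewrite ler_wpM2l//; lra.
have -> : `|L u| / h / (i%:R - 1) = `|L u| * ((i%:R - 1) * h)^-1.
  by rewrite -mulrA -invfM (mulrC h).
have hL : `|L u| * (((i%:R - 1) * h)^-1 + 1 / 2) <= `|L u| / ((i%:R - 1) * h) + 1 / 2.
  by rewrite mulrDr lerD2l ler_piMl.
move: err_le H => e1 e2 e3; exact: kernel_upper_arith e2 e3 hL e1.
Qed.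

Lemma main_kernel_far_ge :
  `|L u| / h / (i%:R + 1) - 18 * q / h ^+ 2 / (i%:R - 1) ^+ 2 - 1 <= `|G u|.
Proof.
have := main_kernel_approx u_neq0 u4; rewrite ler_norml => /andP[H _].
have /andP[S _] := inv_norm_2sin_half u_neq0 u4.
have uV : ((i%:R + 1) * h)^-1 <= `|u|^-1.
  by rewrite lef_pV2 ?posrE// mulr_gt0// ltr_wpDl.
have : `|L u| * (((i%:R + 1) * h)^-1) <= `|L u| / `|2 * sin (u / 2)|.
  by rewrite ler_wpM2l//; lra.
have -> : `|L u| / h / (i%:R + 1) = `|L u| * ((i%:R + 1) * h)^-1.
  by rewrite -mulrA -invfM (mulrC h).
have := err_le; move: (18 * q / h ^+ 2 / _) H => X; lra.
Qed.

End far.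

(* Along a coset of the subgroup generated by [step], |cos (N u / 2 + xi)| is constant
   (carrier_shift), so only a harmonic sum remains to be estimated. *)
Definition coset_sum (s : R) : R := \sum_(i < N) `|G (s + (i%:R - p%:R) * h)|.

Lemma carrier_shift s (i : nat) : `|L (s + i%:R * h)| = `|L s|.
Proof.
rewrite /L /carrier -(normr_cosDnpi (N%:R / 2 * s + xi) i); congr `|cos _|.
have -> : i%:R * pi = N%:R / 2 * (i%:R * h) :> R.
  by rewrite [RHS]mulrCA mulrAC (mulrC N%:R) hN; field.
by ring.
Qed.

Lemma coset_sum_approx s : `|s| <= h / 2 ->
  `|h * coset_sum s - 2 * `|L s| * ln q^-1| <= 60.
Proof.
apply: lattice_sum_approx => //.
- by rewrite -nE.
- by rewrite -NE.
- have n_big : 20000 <= n%:R :> R by exact: n_ge nstarP.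
  by move: n_big; rewrite nE; lra.
- exact: main_kernel_le.
- by move=> u; exact: cos_max.
- exact: carrier_shift.
- by move=> u i i1 u1 u2 u3; exact: main_kernel_far_le.
- by move=> u i i1 u1 u2 u3; exact: main_kernel_far_ge.
Qed.

End kernel.

(** * Integral norm of the main part *)

Section continuous_integrals.
Variable R : realType.
Notation mu := (@lebesgue_measure R).
Implicit Types (g : R -> R) (a b c : R).

Lemma continuous_integrable g a b : continuous g ->
  mu.-integrable `[a, b] (EFin \o g).
Proof.
move=> cg; apply: continuous_compact_integrable; first exact: segment_compact.
exact: continuous_subspaceT.
Qed.

Lemma Rintegral_chasles g a b c : continuous g -> a <= b -> b <= c ->
  \int[mu]_(t in `[a, c]) g t = \int[mu]_(t in `[a, b]) g t + \int[mu]_(t in `[b, c]) g t.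
Proof.
move=> cg ab bc; apply/eqP; rewrite addrC -subr_eq.
rewrite Rintegral_itvB ?bnd_simp//; last exact: continuous_integrable.
rewrite Rintegral_itv_obnd_cbnd//.
apply: integrableS (continuous_integrable b c cg) => //.
exact: subset_itv_oc_cc.
Qed.

Lemma Rintegral_shift g a b c : continuous g -> a <= b ->
  \int[mu]_(t in `[a + c, b + c]) g t = \int[mu]_(t in `[a, b]) g (t + c).
Proof.
move=> cg ab; rewrite /Rintegral.
have D1 : derive1 (fun t : R => t + c) = cst (1 : R).
  by apply/funext => t; rewrite derive1E deriveD//= derive_id derive_cst addr0.
have cs : continuous (fun t : R => t + c).
  by move=> t; apply: cvgD; [exact: cvg_id|exact: cvg_cst].
have H : (\int[mu]_(x in `[(a + c)%R, (b + c)%R]) (g x)%:E =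
    \int[mu]_(x in `[a, b]) (((g \o (fun t => (t + c)%R)) *
      derive1 (fun t => (t + c)%R))%R x)%:E)%E.
  apply: (@integration_by_substitution_increasing R (fun t => t + c) g a b) => //.
  - by move=> x y _ _ xy; rewrite ltrD2r.
  - by rewrite D1 => x _; exact: cvg_cst.
  - by rewrite D1; exact: is_cvg_cst.
  - by rewrite D1; exact: is_cvg_cst.
  - split => //.
    + by apply: cvg_at_right_filter; exact: cs.
    + by apply: cvg_at_left_filter; exact: cs.
  - exact: continuous_subspaceT.
rewrite H; congr fine; apply: eq_integral => t _.
by rewrite D1; congr EFin; exact: mulr1.
Qed.

(** Two overlapping windows differ by end pieces that are translates by T; an arbitrary offset is
    first reduced to this case by whole periods. *)
Lemma Rintegral_periodic g (T : R) a b : 0 < T -> continuous g ->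
  (forall t, g (t + T) = g t) ->
  \int[mu]_(t in `[a, a + T]) g t = \int[mu]_(t in `[b, b + T]) g t.
Proof.
move=> T0 cg gT.
have near_eq u v : u <= v -> v <= u + T ->
    \int[mu]_(t in `[u, u + T]) g t = \int[mu]_(t in `[v, v + T]) g t.
  move=> uv vuT; rewrite (Rintegral_chasles cg uv vuT).
  rewrite (@Rintegral_chasles g v (u + T) (v + T))// ?lerD2r// addrC.
  congr (_ + _); rewrite Rintegral_shift//.
  by apply: eq_Rintegral => t _; rewrite gT.
have step u (k : nat) :
    \int[mu]_(t in `[u, u + T]) g t = \int[mu]_(t in `[u + k%:R * T, u + k%:R * T + T]) g t.
  elim: k => [|k ->]; first by rewrite mul0r addr0.
  rewrite -natr1 mulrDl mul1r addrA; apply: near_eq => //.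
  by rewrite lerDl ltW.
wlog ab : a b / a <= b.
  by move=> W; have [ab|/ltW ba] := leP a b; [exact: W|rewrite -[LHS](W b a)].
rewrite (step a (Num.truncn ((b - a) / T))); apply: near_eq.
  have := truncn_le ((b - a) / T); rewrite divr_ge0 ?subr_ge0 ?(ltW T0)// => /esym.
  by rewrite ler_pdivlMr// lerBrDl => <-.
have := truncnS_gt ((b - a) / T); rewrite ltr_pdivrMr// -natr1 mulrDl mul1r.
by move=> H; apply: ltW; rewrite -addrA -ltrBlDl.
Qed.

Lemma continuous_sumr (m : nat) (g : 'I_m -> R -> R) :
  (forall i, continuous (g i)) -> continuous (fun t => \sum_(i < m) g i t).
Proof.
move=> cg t; elim: m g cg => [|m IH] g cg.
  by under eq_fun do rewrite big_ord0; exact: cvg_cst.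
under eq_fun do rewrite big_ord_recl.
apply: cvgD; first exact: cg.
by apply: IH => i; exact: cg.
Qed.

Lemma Rintegral_bigsum (I : Type) (s : seq I) (h : I -> R -> R) a b :
  (forall i, mu.-integrable `[a, b] (EFin \o h i)) ->
  mu.-integrable `[a, b] (EFin \o (fun t => \sum_(i <- s) h i t)) /\
  \int[mu]_(t in `[a, b]) (\sum_(i <- s) h i t) =
  \sum_(i <- s) \int[mu]_(t in `[a, b]) h i t.
Proof.
move=> ih.
have ig (s' : seq I) : mu.-integrable `[a, b] (EFin \o (fun t => \sum_(i <- s') h i t)).
  rewrite (_ : _ \o _ = fun t => (\sum_(i <- s') (EFin \o h i) t)%E).
    exact: integrable_sum.
  by apply/funext => t /=; rewrite sumEFin.
split=> //; elim: s => [|i s IH].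
  rewrite big_nil; under eq_Rintegral do rewrite big_nil.
  by rewrite Rintegral_cst ?mul0r.
rewrite big_cons -IH -RintegralD//.
by apply: eq_Rintegral => t _; rewrite big_cons.
Qed.

Lemma Rintegral_sum (m : nat) (g : 'I_m -> R -> R) a b :
  (forall i, continuous (g i)) ->
  \int[mu]_(t in `[a, b]) (\sum_(i < m) g i t) =
  \sum_(i < m) \int[mu]_(t in `[a, b]) g i t.
Proof.
by move=> cg; rewrite (Rintegral_bigsum _ _).2// => i; exact: continuous_integrable.
Qed.

Lemma Rintegral_split g (m : nat) a h : 0 <= h -> continuous g ->
  \int[mu]_(t in `[a, a + m%:R * h]) g t =
  \sum_(i < m) \int[mu]_(t in `[a + i%:R * h, a + i%:R * h + h]) g t.
Proof.
move=> h0 cg; elim: m => [|m IH].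
  by rewrite big_ord0 mul0r addr0 set_itv1 Rintegral_set1.
rewrite big_ord_recr/= -IH -natr1 mulrDl mul1r addrA.
apply: Rintegral_chasles => //; last by rewrite lerDl.
by rewrite lerDl mulr_ge0.
Qed.

Lemma Rintegral_itv_cst a b (k : R) : a <= b ->
  \int[mu]_(t in `[a, b]) k = k * (b - a).
Proof.
move=> ab; rewrite Rintegral_cst//= lebesgue_measure_itv/= lte_fin.
case: ltP => [//|ba]; have -> : a = b by apply/eqP; rewrite eq_le ab ba.
by rewrite subrr.
Qed.

Lemma continuous_norm_comp g : continuous g -> continuous (fun t => `|g t|).
Proof. by move=> cg t; apply: cvg_norm; exact: cg. Qed.

Lemma continuous_affine (k c : R) : continuous (fun t : R => k * t + c).
Proof.
move=> t; apply: cvgD; last exact: cvg_cst.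
by apply: cvgM; [exact: cvg_cst|exact: cvg_id].
Qed.

Lemma continuous_cos_affine (k c : R) : continuous (fun t : R => cos (k * t + c)).
Proof.
move=> t; apply: (@continuous_comp _ _ _ (fun t => k * t + c) cos).
  exact: continuous_affine.
exact: continuous_cos.
Qed.

Lemma continuous_sin_affine (k c : R) : continuous (fun t : R => sin (k * t + c)).
Proof.
move=> t; apply: (@continuous_comp _ _ _ (fun t => k * t + c) sin).
  exact: continuous_affine.
exact: continuous_sin.
Qed.

Lemma continuous_shift g c : continuous g -> continuous (fun t => g (t + c)).
Proof.
move=> cg t; apply: (@continuous_comp _ _ _ (fun t => t + c) g); last exact: cg.
by apply: cvgD; [exact: cvg_id|exact: cvg_cst].
Qed.

Lemma continuous_reflect g c : continuous g -> continuous (fun t => g (c - t)).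
Proof.
move=> cg t; apply: (@continuous_comp _ _ _ (fun t => c - t) g); last exact: cg.
by apply: cvgB; [exact: cvg_cst|exact: cvg_id].
Qed.

Lemma Rintegral_FTC (f F : R -> R) a b : a < b -> continuous f ->
  (forall t : R, is_derive t 1 F (f t)) ->
  \int[mu]_(t in `[a, b]) f t = F b - F a.
Proof.
move=> ab cf Ff; rewrite /Rintegral (@continuous_FTC2 R f F a b)//.
- exact: continuous_subspaceT.
- have cF : continuous F.
    by move=> y; apply/differentiable_continuous/derivable1_diffP; have [] := Ff y.
  split.
  + by move=> x _; have [] := Ff x.
  + by apply: cvg_at_right_filter; exact: cF.
  + by apply: cvg_at_left_filter; exact: cF.
- by move=> x _; rewrite derive1E; have [_ ->] := Ff x.
Qed.

Lemma Rintegral_norm_cos (w c : R) a : 0 < w ->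
  \int[mu]_(t in `[a, a + pi / w]) `|cos (w * t + c)| = 2 / w.
Proof.
move=> w0; have T0 : 0 < pi / w by rewrite divr_gt0 ?pi_gt0.
have cc k : continuous (fun t : R => `|cos (w * t + k)|).
  by apply: continuous_norm_comp; exact: continuous_cos_affine.
have per k t : `|cos (w * (t + pi / w) + k)| = `|cos (w * t + k)|.
  have -> : w * (t + pi / w) + k = w * t + k + 1%:R * pi by field; rewrite gt_eqF.
  exact: normr_cosDnpi.
(* The window, one period of |cos|, is moved to where the cosine is nonnegative. *)
rewrite (Rintegral_periodic a (- (pi / w) / 2 - c / w) T0 (cc c) (per c)).
have -> : - (pi / w) / 2 - c / w + pi / w = pi / w / 2 + (- (c / w)).
  by field; rewrite gt_eqF.
rewrite Rintegral_shift//; last by lra.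
transitivity (\int[mu]_(t in `[- (pi / w) / 2, pi / w / 2]) cos (w * t + 0)).
  apply: eq_Rintegral.
  move=> t; rewrite inE/= in_itv/= => /andP[t1 t2].
  have -> : w * (t - c / w) + c = w * t + 0 by field; rewrite gt_eqF.
  rewrite ger0_norm// cos_ge0_pihalf// addr0.
  have E : pi / 2 = w * (pi / w / 2) by field; rewrite gt_eqF.
  rewrite E -mulrN !ler_pM2l//.
  by rewrite t2 andbT -mulNr.
have D (t : R) : is_derive t 1 (fun t : R => sin (w * t) / w) (cos (w * t + 0)).
  rewrite addr0; apply: is_derive_eq; rewrite !scaler0 /GRing.scale/=.
  by field; rewrite gt_eqF.
rewrite (Rintegral_FTC _ _ D); first last.
- exact: continuous_cos_affine.
- by lra.
have -> : w * (pi / w / 2) = pi / 2 by field; rewrite gt_eqF.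
have -> : w * (- (pi / w) / 2) = - (pi / 2) by field; rewrite gt_eqF.
by rewrite sinN sin_pihalf; field; rewrite gt_eqF.
Qed.

End continuous_integrals.

Section main_kernel_norm.
Variables (R : realType) (alpha r xi : R) (p : nat).
Hypotheses (r_gt0 : 0 < r) (r_lt1 : r < 1) (alpha_gt0 : 0 < alpha).
Hypothesis nstarP : nstar_ineq alpha r p.+1.
Notation mu := (@lebesgue_measure R).
Let q := decay alpha r p.+1.
Let G := main_kernel alpha r xi p.

Lemma continuous_main_kernel : continuous G.
Proof.
rewrite /G /main_kernel /sin_sum.
under eq_fun do rewrite -[X in \sum_(X <= _ < _) _]add0n big_addn big_mkord.
apply: continuous_sumr => i t; apply: cvgM; first exact: cvg_cst.
exact: continuous_sin_affine.
Qed.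

Lemma main_kernel_periodic u : G (u + 2 * pi) = G u.
Proof.
rewrite /G /main_kernel /sin_sum; apply: eq_bigr => k _; congr (_ * _).
rewrite -(sinDn2pi (k%:R * u + xi) k); congr sin; by ring.
Qed.

(** The period is cut into N windows of length h centred at (i - p) h, which folds the integral onto
    |s| <= h / 2. The error there is 60 for the integral, hence 30 after division by pi >= 2. *)
Lemma main_kernel_norm x :
  `| pi^-1 * \int[mu]_(t in `[- pi, pi]) `|G (t - x)| - 4 / pi ^+ 2 * ln q^-1 | <= 30.
Proof.
have cG := continuous_main_kernel.
have cnG : continuous (fun t => `|G t|) by exact: continuous_norm_comp.
have pi0 := pi_gt0 R; have pi2 := pi_ge2 R.
pose h := step R p; have h0 : 0 < h by exact: step_gt0.
have hN : p.*2.+1%:R * h = 2 * pi by rewrite mulrC mulfVK// pnatr_eq0.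
have NE : p.*2.+1%:R = 2 * p%:R + 1 :> R by rewrite natN_half.
have -> : \int[mu]_(t in `[- pi, pi]) `|G (t - x)| =
    \int[mu]_(s in `[- (h / 2), h / 2]) coset_sum alpha r xi p s.
  rewrite -(@Rintegral_shift _ (fun t => `|G t|) _ _ (- x))//; last by lra.
  have -> : pi - x = - pi - x + 2 * pi by ring.
  rewrite (@Rintegral_periodic _ _ _ (- pi - x) (- pi)) ?mulr_gt0//; last first.
    by move=> t; rewrite main_kernel_periodic.
  rewrite -hN Rintegral_split ?(ltW h0)//.
  rewrite (@Rintegral_sum _ _ (fun i t => `|G (t + (i%:R - p%:R) * h)|)); last first.
    by move=> i;
      exact: (@continuous_shift _ (fun t => `|G t|) ((i%:R - p%:R) * h) cnG).
  apply: eq_bigr => i _.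
  rewrite -(@Rintegral_shift _ (fun t => `|G t|))//; last by lra.
  have E : - pi = - (h / 2) - p%:R * h.
    by apply: (mulfI (lt0r_neq0 (ltr0n R 2))); rewrite mulrN -hN NE; field.
  have -> : - pi + i%:R * h = - (h / 2) + (i%:R - p%:R) * h by rewrite E; ring.
  by have -> : - (h / 2) + (i%:R - p%:R) * h + h = h / 2 + (i%:R - p%:R) * h by field.
have cS : continuous (coset_sum alpha r xi p).
  apply: continuous_sumr => i.
  exact: (@continuous_shift _ (fun t => `|G t|) ((i%:R - p%:R) * h) cnG).
pose L s := `|carrier xi p s|.
have cL : continuous L by apply: continuous_norm_comp; exact: continuous_cos_affine.
have N0 : p.*2.+1%:R != 0 :> R by rewrite pnatr_eq0.
(* h is exactly half a period of cos (N s / 2 + xi), so the phase xi does not affect the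
   integral. *)
have intL : \int[mu]_(s in `[- (h / 2), h / 2]) L s = 2 * h / pi.
  have := @Rintegral_norm_cos R (p.*2.+1%:R / 2) xi (- (h / 2)).
  have -> : - (h / 2) + pi / (p.*2.+1%:R / 2) = h / 2.
    by rewrite /h /step; move: N0; move: (p.*2.+1%:R) => M M0; field.
  rewrite divr_gt0 ?ltr0n// => ->//.
  rewrite /h /step; move: N0 (lt0r_neq0 pi0); move: (p.*2.+1%:R) (pi) => M P M0 P0.
  by field; rewrite ?M0 ?P0.
pose I := \int[mu]_(s in `[- (h / 2), h / 2]) coset_sum alpha r xi p s.
have hh : - (h / 2) <= h / 2 by lra.
have sE s : `[- (h / 2), h / 2]%classic s -> `|s| <= h / 2.
  by rewrite /= in_itv/= ler_norml.
pose c := 2 * ln q^-1.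
have up : h * I <= c * (2 * h / pi) + 60 * h.
  rewrite -intL /I -!RintegralZl//; try exact: continuous_integrable.
  have -> : 60 * h = \int[mu]_(t in `[- (h / 2), h / 2]) 60.
    by rewrite Rintegral_itv_cst//; field.
  rewrite -RintegralD//; try (apply: continuous_integrable => t).
  - apply: le_Rintegral => //; try (apply: continuous_integrable => t).
    + by apply: cvgM; [exact: cvg_cst|exact: cS].
    + by apply: cvgD; [apply: cvgM; [exact: cvg_cst|exact: cL]|exact: cvg_cst].
    + move=> s /sE sh; have := coset_sum_approx xi r_gt0 r_lt1 alpha_gt0 nstarP sh.
      rewrite ler_norml => /andP[_]; rewrite -/h -/q /c /L; lra.
  - by apply: cvgM; [exact: cvg_cst|exact: cL].
  - exact: cvg_cst.
have lo : c * (2 * h / pi) - 60 * h <= h * I.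
  rewrite -intL /I -!RintegralZl//; try exact: continuous_integrable.
  have -> : 60 * h = \int[mu]_(t in `[- (h / 2), h / 2]) 60.
    by rewrite Rintegral_itv_cst//; field.
  rewrite -RintegralB//; try (apply: continuous_integrable => t).
  - apply: le_Rintegral => //; try (apply: continuous_integrable => t).
    + by apply: cvgB; [apply: cvgM; [exact: cvg_cst|exact: cL]|exact: cvg_cst].
    + by apply: cvgM; [exact: cvg_cst|exact: cS].
    + move=> s /sE sh; have := coset_sum_approx xi r_gt0 r_lt1 alpha_gt0 nstarP sh.
      rewrite ler_norml => /andP[+ _]; rewrite -/h -/q /c /L; lra.
  - by apply: cvgM; [exact: cvg_cst|exact: cL].
  - exact: cvg_cst.
have cE : c * (2 * h / pi) = h * (pi * (4 / pi ^+ 2 * ln q^-1)).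
  rewrite /c; move: (lt0r_neq0 pi0); move: (pi) (ln q^-1) (h) => P l k P0.
  by field; rewrite ?P0.
rewrite cE (mulrC 60) -mulrDr ler_pM2l// in up.
rewrite cE (mulrC 60) -mulrBr ler_pM2l// in lo.
rewrite -/I; set V := 4 / _ * _ in up lo *.
have -> : pi^-1 * I - V = pi^-1 * (I - pi * V).
  by rewrite mulrBr mulrA mulVf ?mul1r// gt_eqF.
rewrite normrM ger0_norm ?invr_ge0 ?(ltW pi0)// mulrC ler_pdivrMr//.
apply: (@le_trans _ _ 60); last by move: pi2; lra.
by rewrite ler_norml; move: up lo; lra.
Qed.

End main_kernel_norm.

(** * The error kernel *)

Section tail_limits.
Variable R : realType.

Lemma natr_pred_inv_small (m : nat) (e : R) : 0 < e ->
  exists2 M : nat, (m <= M)%N & (M.-1%:R)^-1 < e.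
Proof.
move=> e0; exists (m + (Num.truncn e^-1).+2)%N; first by rewrite leq_addr.
rewrite addnS/= -[ltRHS]invrK ltf_pV2 ?posrE ?invr_gt0// ?ltr0n ?addnS//.
by apply: lt_le_trans (truncnS_gt _) _; rewrite ler_nat -addnS leq_addl.
Qed.

(** The modulus 1 / (M - 1) is that of the tails of the sum of k^-2; it passes to the limit and
    gives estimates uniform in the variable t. *)
Lemma tail_cvg (u : nat -> R) (m : nat) :
  (forall M M', (m <= M)%N -> (M <= M')%N -> `|u M' - u M| <= (M.-1%:R)^-1) ->
  cvgn u /\ (forall M, (m <= M)%N -> `|limn u - u M| <= (M.-1%:R)^-1).
Proof.
move=> H; have cu : cvgn u.
  apply/cauchy_cvgP/cauchy_exP => e e0.
  have [M mM Me] := natr_pred_inv_small m e0.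
  exists (u M); exists M => // M' /= MM'.
  by rewrite /ball/= distrC (le_lt_trans _ Me)// H.
split=> // M mM.
have cd : (fun M' => `|u M' - u M|) @ \oo --> `|limn u - u M|.
  by apply: cvg_norm; apply: cvgB; [exact: cu|exact: cvg_cst].
by apply: (cvgr_to_le cd); exists M => // M' /= MM'; exact: H.
Qed.

Lemma uniform_tail_continuous (u : nat -> R -> R) (f : R -> R) (m : nat) :
  (forall M, continuous (u M)) ->
  (forall M t, (m <= M)%N -> `|f t - u M t| <= (M.-1%:R)^-1) -> continuous f.
Proof.
move=> cu H t; apply/cvgrPdist_lt => e e0.
have e3 : 0 < e / 3 by rewrite divr_gt0.
have [M mM Me] := natr_pred_inv_small m e3.
have /cvgrPdist_lt/(_ _ e3) := cu M t.
apply: filterS => s us.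
have -> : f t - f s = (f t - u M t) + (u M t - u M s) - (f s - u M s) by ring.
apply: le_lt_trans (ler_normB _ _) _.
have := ler_normD (f t - u M t) (u M t - u M s).
have := H M t mM; have := H M s mM; move: us Me; lra.
Qed.

End tail_limits.

(** * Convergence and continuity of the Poisson kernel *)

Section poisson_kernel_theory.
Variables (R : realType) (alpha r beta : R) (p : nat).
Let n := p.+1.
Hypotheses (r_gt0 : 0 < r) (r_lt1 : r < 1) (alpha_gt0 : 0 < alpha).
Hypothesis nstarP : nstar_ineq alpha r n.
Let m0 := (3 * n)%N.-1.

Definition poisson_sum (M : nat) (t : R) : R :=
  \sum_(1 <= k < M) expR (- alpha * k%:R `^ r) * cos (k%:R * t - beta * pi / 2).

Let P := poisson_kernel alpha r beta.

Lemma expR_coef k :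
  expR (- alpha * k%:R `^ r) = expR (- alpha * n%:R `^ r) * coef alpha r n k.
Proof. by rewrite /coef -expRD; congr expR; ring. Qed.

Lemma expR_n_le1 : expR (- alpha * n%:R `^ r) <= 1.
Proof. by rewrite expR_le1 mulNr oppr_le0 mulr_ge0 ?powR_ge0// ltW. Qed.

Lemma coef_le_invX3_tail k : (m0 <= k)%N -> coef alpha r n k <= (k%:R ^+ 3)^-1.
Proof.
move=> mk; apply: coef_le_invX3 => //.
by apply: leq_trans mk; rewrite /m0 /n; clear; lia.
Qed.

Lemma sum_inv_sq_tail (M M' : nat) : (m0 <= M)%N -> (M <= M')%N ->
  \sum_(M <= k < M') (k%:R ^+ 2)^-1 <= (M.-1%:R)^-1 :> R.
Proof.
move=> mM MM'; apply: le_trans (sum_inv_sq_le _ _ MM') _.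
  by apply: leq_trans mM; rewrite /m0 /n; clear; lia.
by rewrite gerBl invr_ge0.
Qed.

Lemma poisson_sum_tail M M' t : (m0 <= M)%N -> (M <= M')%N ->
  `|poisson_sum M' t - poisson_sum M t| <= (M.-1%:R)^-1.
Proof.
move=> mM MM'; have M1 : (1 <= M)%N by apply: leq_trans mM; rewrite /m0 /n; clear; lia.
rewrite /poisson_sum (big_cat_nat (n := M) M1 MM')/= addrAC subrr add0r.
apply: le_trans (sum_inv_sq_tail mM MM').
apply: le_trans (ler_norm_sum _ _ _) _; apply: ler_sum_nat => k /andP[Mk _].
have k1 : 1 <= k%:R :> R by rewrite ler1n; exact: leq_trans Mk.
rewrite normrM ger0_norm ?expR_ge0// expR_coef.
apply: (@le_trans _ _ (coef alpha r n k)).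
  rewrite -[leRHS]mulr1; apply: ler_pM => //; last exact: cos_max.
    by rewrite mulr_ge0 ?expR_ge0.
  by rewrite ler_piMl ?expR_n_le1// ltW// coef_gt0.
apply: le_trans (coef_le_invX3_tail (leq_trans mM Mk)) _.
rewrite lef_pV2 ?posrE ?exprn_gt0 ?(lt_le_trans ltr01)//.
by rewrite [leRHS]exprS ler_peMl// exprn_ge0.
Qed.

Lemma poisson_kernel_cvg t : poisson_sum ^~ t @ \oo --> P t.
Proof.
by have [] := @tail_cvg R (poisson_sum ^~ t) m0 (fun M M' => @poisson_sum_tail M M' t).
Qed.

Lemma poisson_kernel_tail M t : (m0 <= M)%N -> `|P t - poisson_sum M t| <= (M.-1%:R)^-1.
Proof.
have [_] := @tail_cvg R (poisson_sum ^~ t) m0 (fun M M' => @poisson_sum_tail M M' t).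
exact.
Qed.

Lemma continuous_poisson_sum M : continuous (poisson_sum M).
Proof.
rewrite /poisson_sum.
under eq_fun do rewrite -[X in \sum_(X <= _ < _) _]add0n big_addn big_mkord.
apply: continuous_sumr => i t; apply: cvgM; first exact: cvg_cst.
exact: continuous_cos_affine.
Qed.

Lemma continuous_poisson_kernel : continuous P.
Proof.
apply: (uniform_tail_continuous continuous_poisson_sum (m := m0)).
exact: poisson_kernel_tail.
Qed.

Lemma poisson_kernel_periodic t : P (t + 2 * pi) = P t.
Proof.
rewrite /P /poisson_kernel; congr (limn _); apply/funext => M.
apply: eq_bigr => k _; congr (_ * _).
rewrite -[RHS](@cosDn2pi R _ k); congr cos; ring.
Qed.

(** * Harmonics of the error kernel *)

Section error_kernel.
Variable x : R.
Let N := p.*2.+1.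
Let W := 2 * sin (N%:R / 2 * x) * expR (- alpha * n%:R `^ r).
Let xi := N%:R / 2 * x + beta * pi / 2.

Definition error_kernel (t : R) : R :=
  P (x - t) - interp_op p (fun y => P (y - t)) x.

Definition error_sum (M : nat) (t : R) : R :=
  poisson_sum M (x - t) - interp_op p (fun y => poisson_sum M (y - t)) x.

Definition error_freq (k : nat) : R :=
  2 * sin ((alias_order p k)%:R * (N%:R / 2 * x)).

Definition error_phase (k : nat) : R :=
  (alias_order p k)%:R * (N%:R / 2 * x) - k%:R * x + beta * pi / 2.

(** Aliasing acts on the interpolated variable only: in t, the harmonic of order k keeps its order.
    Hence orders below n disappear and no lower ones are created. *)
Lemma error_sumE M t : error_sum M t =
  \sum_(1 <= k < M) expR (- alpha * k%:R `^ r) * error_freq k *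
     sin (k%:R * t + error_phase k).
Proof.
rewrite /error_sum /interp_op /poisson_sum.
under [X in _ - X]eq_bigr do rewrite mulr_suml.
rewrite exchange_big/= -sumrB; apply: eq_bigr => k _.
under eq_bigr do rewrite -mulrA.
rewrite -mulr_sumr -mulrBr -[RHS]mulrA; congr (_ * _).
have E y : k%:R * (y - t) - beta * pi / 2 = k%:R * y + (- (k%:R * t) - beta * pi / 2).
  by ring.
rewrite E; under eq_bigr do rewrite E.
rewrite [LHS](interp_error_cos p k (- (k%:R * t) - beta * pi / 2) x) -/N.
rewrite -mulrN -sinN; congr (_ * sin _); rewrite /error_phase; ring.
Qed.

(** The alias order is 0 below n and 1 up to 3n - 2, where the terms form W G. Beyond, |sin (m y)|
    <= m |sin y| <= k |sin y| extracts the same factor W and leaves k^-2, whose sum is at most 1. *)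
Lemma error_sum_main M t : (m0 <= M)%N ->
  `|error_sum M t - W * main_kernel alpha r xi p (t - x)| <= `|W|.
Proof.
move=> mM; have n1 : (1 <= n)%N by [].
have nm : (n <= m0)%N by rewrite /m0 /n; clear; lia.
rewrite error_sumE (big_cat_nat (n := n) n1 (leq_trans nm mM))/=.
rewrite (big_cat_nat (n := m0) nm mM)/=.
have -> : \sum_(1 <= k < n) expR (- alpha * k%:R `^ r) * error_freq k *
     sin (k%:R * t + error_phase k) = 0.
  rewrite big_nat big1// => k /andP[_ kn].
  by rewrite /error_freq alias_order0// mul0r sin0 !mulr0 mul0r.
rewrite add0r.
have -> : \sum_(n <= k < m0) expR (- alpha * k%:R `^ r) * error_freq k *
     sin (k%:R * t + error_phase k) = W * main_kernel alpha r xi p (t - x).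
  rewrite /main_kernel /sin_sum mulr_sumr; apply: eq_big_nat => k /andP[nk km].
  have a1 : alias_order p k = 1%N.
    apply: alias_order1; move: nk km; rewrite /m0 /n; clear; lia.
  rewrite /error_freq /error_phase a1 !mul1r expR_coef /W.
  have -> : k%:R * (t - x) + xi = k%:R * t + (N%:R / 2 * x - k%:R * x + beta * pi / 2).
    by rewrite /xi; ring.
  ring.
rewrite addrAC subrr add0r.
have H : \sum_(m0 <= k < M) (k%:R ^+ 2)^-1 <= (1 : R).
  apply: le_trans (sum_inv_sq_tail (leqnn m0) mM) _.
  rewrite invf_le1 ?ltr0n ?ler1n; last by rewrite /m0 /n; clear; lia.
  by rewrite /m0 /n; clear; lia.
rewrite -[leRHS]mulr1; apply: (@le_trans _ _ (`|W| * \sum_(m0 <= k < M) (k%:R ^+ 2)^-1)).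
  rewrite mulr_sumr; apply: le_trans (ler_norm_sum _ _ _) _.
  apply: ler_sum_nat => k /andP[mk _].
  have k0 : 0 < k%:R :> R.
    by rewrite ltr0n; apply: leq_trans mk; rewrite /m0 /n; clear; lia.
  rewrite !normrM (ger0_norm (expR_ge0 _)) expR_coef.
  have h1 : `|sin (k%:R * t + error_phase k)| <= 1 by exact: sin_max.
  have h2 : 2 * `|sin ((alias_order p k)%:R * (N%:R / 2 * x))| <=
      2 * (k%:R * `|sin (N%:R / 2 * x)|).
    rewrite ler_pM2l//; apply: le_trans (normr_sin_natM _ _) _.
    by rewrite ler_wpM2r// ler_nat alias_order_le.
  have h3 := coef_le_invX3_tail mk.
  have e0 := expR_gt0 (- alpha * n%:R `^ r); have c0 := coef_gt0 alpha r n k.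
  rewrite !(ger0_norm (expR_ge0 _)) !(ger0_norm (ler0n R 2)).
  set e := expR (- alpha * n%:R `^ r) in e0 *; set c := coef _ _ _ _ in c0 h3 *.
  set s := `|sin (N%:R / 2 * x)| in h2 *.
  apply: (@le_trans _ _ (e * (k%:R ^+ 3)^-1 * (2 * (k%:R * s)) * 1)).
    apply: ler_pM => //; first by rewrite !mulr_ge0// ltW.
    apply: ler_pM => //; first by rewrite mulr_ge0// ltW.
    by rewrite ler_pM2l.
  rewrite mulr1 le_eqVlt; apply/orP; left; apply/eqP.
  by move: k0 => /lt0r_neq0; move: (k%:R : R) => K K0; field.
by apply: ler_wpM2l.
Qed.

Lemma error_kernel_cvg t : error_sum ^~ t @ \oo --> error_kernel t.
Proof.
apply: cvgB; first exact: poisson_kernel_cvg.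
apply: cvg_big => [|k _]; first exact: add_continuous.
by apply: cvgM; [exact: poisson_kernel_cvg|exact: cvg_cst].
Qed.

Lemma error_kernel_main t :
  `|error_kernel t - W * main_kernel alpha r xi p (t - x)| <= `|W|.
Proof.
have cd : (fun M => `|error_sum M t - W * main_kernel alpha r xi p (t - x)|) @ \oo -->
    `|error_kernel t - W * main_kernel alpha r xi p (t - x)|.
  by apply: cvg_norm; apply: cvgB; [exact: error_kernel_cvg|exact: cvg_cst].
by apply: (cvgr_to_le cd); exists m0 => // M /= mM; exact: error_sum_main.
Qed.

(** Uniformity in t is what allows integrals over a period to pass to the limit; for this the
    existence of C is enough. *)
Lemma error_kernel_tail : exists C : R, forall M t, (m0 <= M)%N ->
  `|error_kernel t - error_sum M t| <= C * (M.-1%:R)^-1.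
Proof.
exists (1 + \sum_(k < N) `|dirichlet p (x - interp_node R n k)|) => M t mM.
have -> : error_kernel t - error_sum M t =
   (P (x - t) - poisson_sum M (x - t)) - \sum_(k < N)
     (P (interp_node R n k - t) - poisson_sum M (interp_node R n k - t)) *
       dirichlet p (x - interp_node R n k).
  rewrite /error_kernel /error_sum /interp_op.
  under [X in _ = _ - X]eq_bigr do rewrite mulrBl.
  rewrite sumrB; ring.
apply: le_trans (ler_normB _ _) _; rewrite mulrDl mul1r; apply: lerD.
  exact: poisson_kernel_tail.
apply: le_trans (ler_norm_sum _ _ _) _; rewrite mulr_suml; apply: ler_sum => k _.
by rewrite normrM mulrC ler_wpM2l// poisson_kernel_tail.
Qed.

Lemma continuous_error_kernel : continuous error_kernel.
Proof.
move=> t; apply: cvgB; first exact: (@continuous_reflect _ P x continuous_poisson_kernel t).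
apply: (@continuous_sumr _ _ (fun k t => P (interp_node R n k - t) *
  dirichlet p (x - interp_node R n k))) => k s.
apply: cvgM; last exact: cvg_cst.
exact: (@continuous_reflect _ P _ continuous_poisson_kernel s).
Qed.

Lemma continuous_error_sum M : continuous (error_sum M).
Proof.
move=> t; apply: cvgB.
  exact: (@continuous_reflect _ (poisson_sum M) x (@continuous_poisson_sum M) t).
apply: (@continuous_sumr _ _ (fun k t => poisson_sum M (interp_node R n k - t) *
  dirichlet p (x - interp_node R n k))) => k s.
apply: cvgM; last exact: cvg_cst.
exact: (@continuous_reflect _ (poisson_sum M) _ (@continuous_poisson_sum M) s).
Qed.

End error_kernel.

End poisson_kernel_theory.

(** * Integrals against essentially bounded functions *)

Section bounded_integrands.
Variable R : realType.
Notation mu := (@lebesgue_measure R).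
Implicit Types (g Q phi psi : R -> R) (a b A : R).

Lemma integrable_mul_ae_bounded Q phi A a b : 0 <= A -> continuous Q ->
  measurable_fun [set: measurableTypeR R] phi ->
  {ae mu, forall t, `|phi t| <= A} ->
  mu.-integrable `[a, b] (EFin \o (fun t => Q t * phi t)) /\
  `|\int[mu]_(t in `[a, b]) (Q t * phi t)| <= A * \int[mu]_(t in `[a, b]) `|Q t|.
Proof.
move=> A0 cQ mphi phiA.
have mQ : measurable_fun [set: measurableTypeR R] Q by exact: continuous_measurable_fun.
have mQphi : measurable_fun [set: measurableTypeR R] (fun t => Q t * phi t).
  exact: measurable_funM.
have iQ : mu.-integrable `[a, b] (EFin \o (fun t => A * `|Q t|)).
  apply: continuous_integrable => t; apply: cvgM; first exact: cvg_cst.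
  exact: continuous_norm_comp.
have le : (\int[mu]_(t in `[a, b]) `|(Q t * phi t)%:E| <=
    \int[mu]_(t in `[a, b]) `|(A * `|Q t|)%:E|)%E.
  apply: ae_ge0_le_integral => //.
  - apply: measurableT_comp => //; apply/measurable_EFinP.
    exact: measurable_funTS.
  - by apply: measurableT_comp => //; exact: (measurable_int mu).
  - case: phiA => M [mM M0 sM]; exists M; split=> // t /= H; apply: sM => /= phit.
    apply: H => _; rewrite lee_fin normrM mulrC.
    by apply: le_trans (ler_norm _); rewrite ler_wpM2r.
have iQphi : mu.-integrable `[a, b] (EFin \o (fun t => Q t * phi t)).
  apply/integrableP; split.
    by apply/measurable_EFinP; exact: measurable_funTS.
  by apply: le_lt_trans le _; have /integrableP[] := iQ.
split=> //; apply: le_trans (le_normr_Rintegral _ iQphi) _ => //.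
rewrite -RintegralZl//; last exact: (continuous_integrable _ _ (continuous_norm_comp cQ)).
have inQ : mu.-integrable `[a, b] (EFin \o (fun t => `|Q t * phi t|)).
  by have := integrable_abse iQphi.
rewrite /Rintegral fine_le//.
- exact: integrable_fin_num.
- exact: integrable_fin_num.
apply: le_trans le _; rewrite le_eqVlt; apply/orP; left; apply/eqP.
by apply: eq_integral => t _; rewrite /= ger0_norm// mulr_ge0.
Qed.

End bounded_integrands.

(** * Orthogonality of harmonics over a period *)

Section orthogonality.
Variable R : realType.
Notation mu := (@lebesgue_measure R).

Lemma Rintegral_sin_period (m : nat) (c : R) : (0 < m)%N ->
  \int[mu]_(t in `[- pi, pi]) sin (m%:R * t + c) = 0.
Proof.
move=> m0; have m0' : m%:R != 0 :> R by rewrite pnatr_eq0 -lt0n.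
have pi0 := pi_gt0 R.
have D (t : R) : is_derive t 1 (fun t : R => - (cos (m%:R * t + c) / m%:R))
    (sin (m%:R * t + c)).
  apply: is_derive_eq; rewrite !scaler0 !scaler1 /GRing.scale/=.
  by field.
rewrite (Rintegral_FTC _ _ D).
- have -> : m%:R * pi + c = m%:R * (- pi) + c + 2 * pi * m%:R by ring.
  by rewrite cosDn2pi subrr.
- by lra.
- exact: continuous_sin_affine.
Qed.

Lemma Rintegral_sin_cos (k j : nat) (a b : R) : (j < k)%N ->
  \int[mu]_(t in `[- pi, pi]) (sin (k%:R * t + a) * cos (j%:R * t + b)) = 0.
Proof.
move=> jk.
transitivity (\int[mu]_(t in `[- pi, pi]) (1 / 2 * sin ((k + j)%N%:R * t + (a + b)) +
    1 / 2 * sin ((k - j)%N%:R * t + (a - b)))).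
  apply: eq_Rintegral => t _; rewrite natrD natrB ?(ltnW jk)//.
  have -> : (k%:R + j%:R) * t + (a + b) = k%:R * t + a + (j%:R * t + b) by ring.
  have -> : (k%:R - j%:R) * t + (a - b) = k%:R * t + a - (j%:R * t + b) by ring.
  by rewrite (sinB (k%:R * t + a)) (sinD (k%:R * t + a)); field.
have ci (m : nat) c : mu.-integrable `[- pi, pi]
    (EFin \o (fun t : R => sin (m%:R * t + c))).
  by apply: continuous_integrable; exact: continuous_sin_affine.
have ci2 (m : nat) c : mu.-integrable `[- pi, pi]
    (EFin \o (fun t : R => 1 / 2 * sin (m%:R * t + c))).
  apply: continuous_integrable => t; apply: cvgM; first exact: cvg_cst.
  exact: continuous_sin_affine.
rewrite RintegralD// !RintegralZl// !Rintegral_sin_period ?mulr0 ?addr0//.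
  by rewrite subn_gt0.
by rewrite addn_gt0 (leq_ltn_trans _ jk).
Qed.

Lemma continuous_scale (k : R) : continuous (fun t : R => k * t).
Proof. by move=> t; apply: cvgM; [exact: cvg_cst|exact: cvg_id]. Qed.

Lemma continuous_cos_scale (k : R) : continuous (fun t : R => cos (k * t)).
Proof.
move=> t; apply: (@continuous_comp _ _ _ (fun t => k * t) cos).
  exact: continuous_scale.
exact: continuous_cos.
Qed.

Lemma continuous_sin_scale (k : R) : continuous (fun t : R => sin (k * t)).
Proof.
move=> t; apply: (@continuous_comp _ _ _ (fun t => k * t) sin).
  exact: continuous_scale.
exact: continuous_sin.
Qed.

Lemma continuous_trig (n : nat) (T : R -> R) : trig_space n T -> continuous T.
Proof.
move=> [a [b ->]]; apply: (@continuous_sumr _ _ (fun k x => a k * cos (k%:R * x) +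
  b k * sin (k%:R * x))) => k t.
apply: cvgD; (apply: cvgM; first exact: cvg_cst).
  exact: continuous_cos_scale.
exact: continuous_sin_scale.
Qed.

Lemma Rintegral_sin_trig (n k : nat) (c : R) (T : R -> R) : trig_space n T -> (n <= k)%N ->
  \int[mu]_(t in `[- pi, pi]) (sin (k%:R * t + c) * T t) = 0.
Proof.
move=> [a [b ->]] nk.
(* The sines of T are written as cosines shifted by pi / 2, so that [Rintegral_sin_cos] handles both
   kinds. *)
transitivity (\int[mu]_(t in `[- pi, pi]) (\sum_(j < n)
   (a j * (sin (k%:R * t + c) * cos (j%:R * t + 0)) +
    b j * (sin (k%:R * t + c) * cos (j%:R * t + - (pi / 2)))))).
  apply: eq_Rintegral => t _; rewrite mulr_sumr; apply: eq_bigr => j _.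
  by rewrite cosBpihalf addr0; ring.
have ci (j : nat) d : mu.-integrable `[- pi, pi]
    (EFin \o (fun t : R => sin (k%:R * t + c) * cos (j%:R * t + d))).
  apply: continuous_integrable => t; apply: cvgM; first exact: continuous_sin_affine.
  exact: continuous_cos_affine.
have ci2 (j : nat) d e : mu.-integrable `[- pi, pi]
    (EFin \o (fun t : R => e * (sin (k%:R * t + c) * cos (j%:R * t + d)))).
  apply: continuous_integrable => t; apply: cvgM; first exact: cvg_cst.
  apply: cvgM; first exact: continuous_sin_affine.
  exact: continuous_cos_affine.
rewrite (Rintegral_bigsum (index_enum 'I_n) _).2.
  rewrite big1// => j _; have jk : (j < k)%N by exact: leq_trans nk.
  by rewrite RintegralD// !RintegralZl// !Rintegral_sin_cos// !mulr0 addr0.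
move=> j; apply: continuous_integrable => t.
apply: cvgD; (apply: cvgM; first exact: cvg_cst);
  (apply: cvgM; first exact: continuous_sin_affine); exact: continuous_cos_affine.
Qed.

End orthogonality.

(** * Orthogonality and integral norm of the error kernel *)

Section error_kernel_integrals.
Variables (R : realType) (alpha r beta : R) (p : nat) (x : R).
Let n := p.+1.
Let N := p.*2.+1.
Notation mu := (@lebesgue_measure R).
Hypotheses (r_gt0 : 0 < r) (r_lt1 : r < 1) (alpha_gt0 : 0 < alpha).
Hypothesis nstarP : nstar_ineq alpha r n.
Let P := poisson_kernel alpha r beta.
Let Q := error_kernel alpha r beta p x.
Let W := 2 * sin (N%:R / 2 * x) * expR (- alpha * n%:R `^ r).
Let G t := main_kernel alpha r (N%:R / 2 * x + beta * pi / 2) p (t - x).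
Let cP : continuous P. Proof. exact: continuous_poisson_kernel nstarP. Qed.
Let cQ : continuous Q.
Proof. exact: (continuous_error_kernel r_gt0 r_lt1 alpha_gt0 nstarP). Qed.
Let cG : continuous G.
Proof. exact: (@continuous_shift _ _ (- x) (@continuous_main_kernel _ _ _ _ _)). Qed.

Lemma error_sum_orthogonal M (T : R -> R) : trig_space n T ->
  \int[mu]_(t in `[- pi, pi]) (error_sum alpha r beta p x M t * T t) = 0.
Proof.
move=> TT; under eq_Rintegral do rewrite error_sumE mulr_suml.
have cT := continuous_trig TT.
rewrite (Rintegral_bigsum (index_iota 1 M) _).2.
  rewrite big1// => k _; under eq_Rintegral do rewrite -mulrA.
  rewrite RintegralZl//; last first.
    apply: continuous_integrable => t; apply: cvgM; first exact: continuous_sin_affine.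
    exact: cT.
  have [kp|pk] := leqP k p; last by rewrite (Rintegral_sin_trig _ TT)// mulr0.
  by rewrite /error_freq alias_order0// mul0r sin0 !mulr0 mul0r.
move=> k; apply: continuous_integrable => t; apply: cvgM; last exact: cT.
apply: cvgM; first exact: cvg_cst.
exact: continuous_sin_affine.
Qed.

(** The partial sums are exactly orthogonal to T, and the uniform tail bound makes the integral for
    Q smaller than every positive e. *)
Lemma error_kernel_orthogonal (T : R -> R) : trig_space n T ->
  \int[mu]_(t in `[- pi, pi]) (Q t * T t) = 0.
Proof.
move=> TT; have cT := continuous_trig TT; have pi0 := pi_gt0 R.
have [C CH] := error_kernel_tail beta r_gt0 r_lt1 alpha_gt0 nstarP x.
pose I := \int[mu]_(t in `[- pi, pi]) `|T t|.
have I0 : 0 <= I by apply: Rintegral_ge0.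
have B M : ((3 * n).-1 <= M)%N ->
    `|\int[mu]_(t in `[- pi, pi]) (Q t * T t)| <= `|C| * I * (M.-1%:R)^-1.
  move=> mM; rewrite -[X in `|X|]subr0 -(error_sum_orthogonal M TT).
  have cE : continuous (error_sum alpha r beta p x M) by exact: continuous_error_sum.
  rewrite -RintegralB//; try (apply: continuous_integrable => t; apply: cvgM); last first.
  - exact: cT.
  - exact: cE.
  - exact: cT.
  - exact: cQ.
  have cD : continuous (fun t => Q t * T t - error_sum alpha r beta p x M t * T t).
    move=> t; apply: cvgB; apply: cvgM; [exact: cQ|exact: cT|exact: cE|exact: cT].
  apply: le_trans (le_normr_Rintegral _ (continuous_integrable _ _ cD)) _ => //.
  rewrite mulrAC -RintegralZl//;
    last exact: (continuous_integrable _ _ (continuous_norm_comp cT)).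
  apply: le_Rintegral => //.
  - exact: (continuous_integrable _ _ (continuous_norm_comp cD)).
  - apply: continuous_integrable => t; apply: cvgM; first exact: cvg_cst.
    exact: (continuous_norm_comp cT).
  move=> t _; rewrite -mulrBl normrM ler_wpM2r//.
  apply: le_trans (CH _ t mM) _; rewrite ler_wpM2r ?invr_ge0//; exact: ler_norm.
apply/eqP; rewrite -normr_le0; apply/ler_addgt0Pl => e e0; rewrite addr0.
have K0 : 0 < `|C| * I + 1 by rewrite ltr_wpDl// mulr_ge0.
have [M mM Me] := @natr_pred_inv_small R (3 * n).-1 (e / (`|C| * I + 1)) (divr_gt0 e0 K0).
apply: le_trans (B M mM) _.
apply: (@le_trans _ _ ((`|C| * I + 1) * (M.-1%:R)^-1)).
  by rewrite ler_wpM2r ?invr_ge0// lerDl.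
by rewrite mulrC -ler_pdivlMr// ltW.
Qed.

(** Pointwise |Q| <= |W| (|G| + 1), and the 1 contributes 2 pi / pi: hence 32 = 30 + 2. *)
Lemma error_kernel_L1 :
  pi^-1 * \int[mu]_(t in `[- pi, pi]) `|Q t| <=
    `|W| * (4 / pi ^+ 2 * ln (decay alpha r n)^-1 + 32).
Proof.
have pi0 := pi_gt0 R.
have GH := main_kernel_norm (N%:R / 2 * x + beta * pi / 2) r_gt0 r_lt1 alpha_gt0 nstarP x.
have cnG := continuous_norm_comp cG.
have inG := continuous_integrable (- pi) pi cnG.
have i1 : mu.-integrable `[- pi, pi] (EFin \o (fun _ : R => 1)).
  by apply: continuous_integrable => t; exact: cvg_cst.
have iG1 : mu.-integrable `[- pi, pi] (EFin \o (fun t : R => `|G t| + 1)).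
  by apply: continuous_integrable => t; apply: cvgD; [exact: cnG|exact: cvg_cst].
have H : \int[mu]_(t in `[- pi, pi]) `|Q t| <=
    `|W| * (\int[mu]_(t in `[- pi, pi]) `|G t| + 2 * pi).
  have -> : 2 * pi = \int[mu]_(t in `[- pi, pi]) (1 : R).
    by rewrite Rintegral_itv_cst; [ring|lra].
  rewrite -RintegralD// -RintegralZl//; apply: le_Rintegral => //.
  - exact: (continuous_integrable _ _ (continuous_norm_comp cQ)).
  - apply: continuous_integrable => t; apply: cvgM; first exact: cvg_cst.
    by apply: cvgD; [exact: cnG|exact: cvg_cst].
  move=> t _; have := error_kernel_main beta r_gt0 r_lt1 alpha_gt0 nstarP x t.
  rewrite -/Q -/W -/(G t) => h.
  have -> : Q t = W * G t + (Q t - W * G t) by rewrite addrC subrK.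
  by apply: le_trans (ler_normD _ _) _; rewrite normrM mulrDr mulr1 lerD2l.
rewrite ler_norml in GH; case/andP: GH => _ GH.
apply: (@le_trans _ _ (pi^-1 * (`|W| * (\int[mu]_(t in `[- pi, pi]) `|G t| + 2 * pi)))).
  by rewrite ler_pM2l ?invr_gt0.
rewrite mulrCA mulrDr (mulrC _ (2 * pi)) mulfK ?gt_eqF//; apply: ler_wpM2l => //.
by move: GH; rewrite -/G; lra.
Qed.

(* A continuous substitute for the sign of G: the integral of G (G / (|G| + 1)) is that
   of |G| up to 2 pi. *)
Definition smoothed_sign (t : R) : R := G t / (`|G t| + 1).

Lemma smoothed_sign_le1 t : `|smoothed_sign t| <= 1.
Proof.
have G1 : 0 < `|G t| + 1 by rewrite ltr_wpDl.
by rewrite normrM normfV (gtr0_norm G1) ler_pdivrMr// mul1r lerDl.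
Qed.

Lemma continuous_smoothed_sign : continuous smoothed_sign.
Proof.
move=> t; apply: cvgM; first exact: cG.
apply: cvgV; first by rewrite gt_eqF// ltr_wpDl.
by apply: cvgD; [exact: (continuous_norm_comp cG)|exact: cvg_cst].
Qed.

Lemma smoothed_sign_periodic t : smoothed_sign (t + 2 * pi) = smoothed_sign t.
Proof. by rewrite /smoothed_sign /G addrAC main_kernel_periodic. Qed.

(** Here 34 = 30 + 2 + 2: one 2 is lost by smoothing, as G^2 / (|G| + 1) >= |G| - 1, and the other
    by replacing Q with W G. *)
Lemma error_kernel_smoothed_sign :
  `|W| * (4 / pi ^+ 2 * ln (decay alpha r n)^-1 - 34) <=
  pi^-1 * `|\int[mu]_(t in `[- pi, pi]) (Q t * smoothed_sign t)|.
Proof.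
have pi0 := pi_gt0 R; have cS := continuous_smoothed_sign.
have GH := main_kernel_norm (N%:R / 2 * x + beta * pi / 2) r_gt0 r_lt1 alpha_gt0 nstarP x.
rewrite ler_norml in GH; case/andP: GH => GH _.
have cnG := continuous_norm_comp cG.
have i1 (k : R) : mu.-integrable `[- pi, pi] (EFin \o (fun _ : R => k)).
  by apply: continuous_integrable => t; exact: cvg_cst.
have int_cst (k : R) : \int[mu]_(t in `[- pi, pi]) k = k * (2 * pi).
  by rewrite Rintegral_itv_cst; [ring|lra].
have cGS : continuous (fun t => G t * smoothed_sign t).
  by move=> t; apply: cvgM; [exact: cG|exact: cS].
have h1 : \int[mu]_(t in `[- pi, pi]) `|G t| - 2 * pi <=
    \int[mu]_(t in `[- pi, pi]) (G t * smoothed_sign t).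
  rewrite -[2 * pi]mul1r -int_cst -RintegralB//; last exact: continuous_integrable.
  apply: le_Rintegral => //.
  - by apply: continuous_integrable => t; apply: cvgB; [exact: cnG|exact: cvg_cst].
  - exact: continuous_integrable.
  move=> t _; rewrite /smoothed_sign; have G1 : 0 < `|G t| + 1 by rewrite ltr_wpDl.
  rewrite mulrA ler_pdivlMr// -expr2 -real_normK ?num_real//.
  by rewrite -subr_sqr expr1n lerBlDr lerDl.
pose D t := (Q t - W * G t) * smoothed_sign t.
have cD : continuous D.
  move=> t; apply: cvgM; last exact: cS.
  by apply: cvgB; [exact: cQ|apply: cvgM; [exact: cvg_cst|exact: cG]].
have h2 : `|\int[mu]_(t in `[- pi, pi]) D t| <= `|W| * (2 * pi).
  apply: le_trans (le_normr_Rintegral _ (continuous_integrable _ _ cD)) _ => //.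
  rewrite -int_cst; apply: le_Rintegral => //.
    exact: (continuous_integrable _ _ (continuous_norm_comp cD)).
  move=> t _; rewrite normrM -[leRHS]mulr1; apply: ler_pM => //.
    exact: error_kernel_main.
  exact: smoothed_sign_le1.
have E : \int[mu]_(t in `[- pi, pi]) (Q t * smoothed_sign t) =
    W * \int[mu]_(t in `[- pi, pi]) (G t * smoothed_sign t) +
    \int[mu]_(t in `[- pi, pi]) D t.
  rewrite -RintegralZl//; last exact: continuous_integrable.
  rewrite -RintegralD//; last 2 first.
  - by apply: continuous_integrable => t; apply: cvgM; [exact: cvg_cst|exact: cGS].
  - exact: continuous_integrable.
  by apply: eq_Rintegral => t _; rewrite /D; ring.
have h3 : `|W| * (\int[mu]_(t in `[- pi, pi]) (G t * smoothed_sign t)) <=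
    `|W * \int[mu]_(t in `[- pi, pi]) (G t * smoothed_sign t)|.
  by rewrite (normrM W) ler_wpM2l// ler_norm.
have h4 : `|W| * (\int[mu]_(t in `[- pi, pi]) `|G t| - 2 * pi - 2 * pi) <=
    `|\int[mu]_(t in `[- pi, pi]) (Q t * smoothed_sign t)|.
  move: E h2; move: (\int[mu]_(t in `[- pi, pi]) D t) => Y -> h2.
  set X := W * _ in h3 *.
  have h5 : `|X| <= `|X + Y| + `|Y|.
    by rewrite -{1}(addrK Y X); exact: ler_normB.
  have h6 : `|W| * (\int[mu]_(t in `[- pi, pi]) `|G t| - 2 * pi) <= `|X|.
    by apply: le_trans h3; rewrite ler_wpM2l.
  rewrite mulrBr; move: h2 h5 h6; move: (`|W| * (2 * pi)) (`|W| * (_ - _)) => u v; lra.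
apply: (@le_trans _ _
  (pi^-1 * (`|W| * (\int[mu]_(t in `[- pi, pi]) `|G t| - 2 * pi - 2 * pi)))).
  rewrite mulrCA ler_wpM2l// !mulrBr.
  have -> : pi^-1 * (2 * pi) = 2 :> R by rewrite mulrC mulfK// gt_eqF.
  by move: GH; rewrite -/G; lra.
by rewrite ler_pM2l ?invr_gt0.
Qed.

End error_kernel_integrals.

(** * Best approximation *)

Section best_approximation.
Variable R : realType.
Implicit Types (g t : R -> R) (n : nat).

Lemma trig_space_cst n (c : R) : (0 < n)%N -> trig_space n (fun=> c).
Proof.
move=> n0; rewrite (_ : (fun=> c) = fun x : R => c * cos (0%:R * x + 0)).
  by apply: trig_spaceZ; exact: trig_space_cos.
by apply/funext => x; rewrite mul0r addr0 cos0 mulr1.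
Qed.

Lemma trig_space_bounded n t : trig_space n t -> exists M, forall x, `|t x| <= M.
Proof.
move=> [a [b ->]]; exists (\sum_(k < n) (`|a k| + `|b k|)) => x.
apply: le_trans (ler_norm_sum _ _ _) _; apply: ler_sum => k _.
apply: le_trans (ler_normD _ _) _; rewrite !normrM; apply: lerD.
  by rewrite ler_piMr// cos_max.
by rewrite ler_piMr// sin_max.
Qed.

Lemma Cper_bounded g : Cper R g -> exists M, forall x, `|g x| <= M.
Proof.
move=> [gper cg]; have pi0 := pi_gt0 R.
have T0 : 0 < 2 * pi :> R by rewrite mulr_gt0.
have [c _ cmax] := @EVT_max R (fun x => `|g x|) 0 (2 * pi) (ltW T0)
  (continuous_subspaceT (continuous_norm_comp cg)).
exists `|g c| => x.
have gk (k : nat) y : g (y + k%:R * (2 * pi)) = g y.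
  by rewrite mulr_natl periodicn.
wlog x0 : x / 0 <= x.
  move=> W; have [|x0] := leP 0 x; first exact: W.
  rewrite -(gk (Num.truncn (- x / (2 * pi))).+1); apply: W.
  by rewrite -lerBlDl sub0r -ler_pdivrMr// ltW// truncnS_gt.
have xE : x = x - (Num.truncn (x / (2 * pi)))%:R * (2 * pi) +
    (Num.truncn (x / (2 * pi)))%:R * (2 * pi) by rewrite subrK.
rewrite xE gk; apply: cmax; rewrite in_itv/=.
have /andP[h1 h2] := truncn_itv (divr_ge0 x0 (ltW T0)).
rewrite subr_ge0 -ler_pdivlMr// h1/= lerBlDr.
by rewrite -[X in X + _]mul1r -mulrDl (addrC 1) natr1 -ler_pdivrMr// ltW.
Qed.

Lemma supnorm_ge0 g : 0 <= supnorm g.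
Proof.
rewrite /supnorm; set S := [set _ | _ in _].
have [hS|nS] := pselect (has_sup S); last by rewrite sup_out.
by apply: le_trans (ub_le_sup hS.2 _); [exact: normr_ge0 (g 0)|exists 0].
Qed.

Lemma le_supnorm g M x : (forall y, `|g y| <= M) -> `|g x| <= supnorm g.
Proof.
move=> gM; apply: ub_le_sup; last by exists x.
by exists M => _ [y _ <-].
Qed.

Lemma supnorm_le g M : (forall y, `|g y| <= M) -> supnorm g <= M.
Proof. by move=> gM; apply: ge_sup; [exists `|g 0|, 0|move=> _ [y _ <-]]. Qed.

Lemma En_C_le n g t : trig_space n t -> En_C n g <= supnorm (fun x => g x - t x).
Proof.
move=> tn; apply: ge_inf; last by exists t.
by exists 0 => _ [u _ <-]; exact: supnorm_ge0.
Qed.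

Lemma En_C_ge n g (K : R) :
  (forall t, trig_space n t -> K <= supnorm (fun x => g x - t x)) -> K <= En_C n g.
Proof.
move=> H; apply: lb_le_inf; last by move=> _ [u un <-]; exact: H.
by exists (supnorm (fun x => g x - 0)), (fun=> 0) => //; exact: trig_space0.
Qed.

Lemma En_C_ge0 n g : 0 <= En_C n g.
Proof. by apply: En_C_ge => t _; exact: supnorm_ge0. Qed.

Lemma En_C_affine_le n g (k d M : R) : (0 < n)%N -> 0 < k -> (forall x, `|g x| <= M) ->
  En_C n (fun x => k * g x + d) <= k * En_C n g.
Proof.
move=> n0 k0 gM; rewrite -ler_pdivrMl//; apply: En_C_ge => t tn.
rewrite ler_pdivrMl//.
have tn' : trig_space n (fun x => k * t x + d).
  by apply: trig_spaceD; [exact: trig_spaceZ|exact: trig_space_cst].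
apply: le_trans (En_C_le _ tn') _; apply: supnorm_le => y.
have -> : k * g y + d - (k * t y + d) = k * (g y - t y) by ring.
have [K tK] := trig_space_bounded tn.
rewrite normrM gtr0_norm// ler_pM2l//.
apply: (@le_supnorm (fun x => g x - t x) (M + K) y) => z.
by apply: le_trans (ler_normB _ _) _; apply: lerD.
Qed.

(** The reverse inequality is the direct one for the inverse affine map. Boundedness of g makes the
    suprema genuine, since [sup] of an unbounded set is 0. *)
Lemma En_C_affine n g (k d M : R) : (0 < n)%N -> 0 < k -> (forall x, `|g x| <= M) ->
  En_C n (fun x => k * g x + d) = k * En_C n g.
Proof.
move=> n0 k0 gM; apply/eqP; rewrite eq_le (En_C_affine_le d n0 k0 gM)/=.
have kV0 : 0 < k^-1 by rewrite invr_gt0.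
have gM' x : `|k * g x + d| <= k * M + `|d|.
  apply: le_trans (ler_normD _ _) _.
  by rewrite lerD2r normrM gtr0_norm// ler_pM2l.
have := En_C_affine_le (- (k^-1 * d)) n0 kV0 gM'.
rewrite (_ : (fun x => _) = g) ?ler_pdivlMl//; apply/funext => x.
by rewrite mulrDr mulKf ?gt_eqF// addrK.
Qed.

Lemma Lnorm_infty_ae g A :
  (Lnorm (@lebesgue_measure R) +oo (EFin \o g) <= A%:E)%E ->
  {ae (@lebesgue_measure R), forall x, `|g x| <= A}.
Proof.
rewrite Lnorm.unlock /=; case: ifPn => [_ /ess_supP|].
  by case=> M [mM M0 sM]; exists M; split=> // x /= H; apply: sM => /= h; apply: H.
(* In this branch the whole line would have measure zero, so any property holds almost
   everywhere. *)
rewrite -leNgt => h _; apply: measure0_ae.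
by apply/eqP; rewrite eq_le measure_ge0 andbT.
Qed.

End best_approximation.

(** * Upper bound for the interpolation error and extremal functions *)

Section interpolation_error.
Variables (R : realType) (alpha r beta : R) (p : nat) (x : R).
Let n := p.+1.
Let N := p.*2.+1.
Notation mu := (@lebesgue_measure R).
Hypotheses (r_gt0 : 0 < r) (r_lt1 : r < 1) (alpha_gt0 : 0 < alpha).
Hypothesis nstarP : nstar_ineq alpha r n.
Let P := poisson_kernel alpha r beta.
Let Q := error_kernel alpha r beta p x.
Let W := 2 * sin (N%:R / 2 * x) * expR (- alpha * n%:R `^ r).
Let c := 4 / pi ^+ 2 * ln (decay alpha r n)^-1.

(** The constant a0 / 2 drops out because interpolation reproduces constants. Requiring
    integrability of g phi for continuous g covers both bounded and continuous phi. *)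
Lemma interp_error_integral (f phi : R -> R) (a0 : R) :
  (forall (g : R -> R) a b, continuous g ->
    mu.-integrable `[a, b] (EFin \o (fun t => g t * phi t))) ->
  (forall y, f y = a0 / 2 + pi^-1 *
     \int[mu]_(t in `[- pi, pi]) (poisson_kernel alpha r beta (y - t) * phi t)) ->
  interp_error n f x = pi^-1 * \int[mu]_(t in `[- pi, pi]) (Q t * phi t).
Proof.
move=> iphi fE; have cP : continuous P by exact: continuous_poisson_kernel nstarP.
rewrite interp_errorE.
pose J y := \int[mu]_(t in `[- pi, pi]) (P (y - t) * phi t).
pose d (k : 'I_N) := dirichlet p (x - interp_node R n k).
have sd : \sum_(k < N) d k = 1.
  rewrite -[RHS](@interp_op_trig R p (fun=> 1) x); last exact: trig_space_cst.
  by apply: eq_bigr => k _; rewrite mul1r.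
have iP y : mu.-integrable `[- pi, pi] (EFin \o (fun t => P (y - t) * phi t)).
  exact: (iphi (fun t => P (y - t)) _ _ (@continuous_reflect _ P y cP)).
have iPd (k : 'I_N) : mu.-integrable `[- pi, pi]
    (EFin \o (fun t => d k * (P (interp_node R n k - t) * phi t))).
  have cg : continuous (fun t => d k * P (interp_node R n k - t)).
    move=> t; apply: cvgM; first exact: cvg_cst.
    exact: (@continuous_reflect _ P _ cP t).
  have := iphi _ (- pi) pi cg.
  rewrite (_ : (fun t => _ * phi t) =
    (fun t => d k * (P (interp_node R n k - t) * phi t)))//.
  by apply/funext => t; rewrite mulrA.
have [isum Esum] := Rintegral_bigsum (index_enum 'I_N) iPd.
have E : \int[mu]_(t in `[- pi, pi]) (Q t * phi t) =
    J x - \sum_(k < N) d k * J (interp_node R n k).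
  transitivity (\int[mu]_(t in `[- pi, pi]) (P (x - t) * phi t -
      \sum_(k < N) d k * (P (interp_node R n k - t) * phi t))).
    apply: eq_Rintegral => t _; rewrite /Q /error_kernel mulrBl; congr (_ - _).
    rewrite /interp_op mulr_suml; apply: eq_bigr => k _.
    by rewrite -/(d k) -/P; ring.
  rewrite RintegralB// Esum; congr (_ - _); apply: eq_bigr => k _.
  by rewrite RintegralZl.
rewrite E fE -/P -/(J x) /interp_op.
under eq_bigr => k _ do rewrite fE -/P -/(J _) -/(d k) mulrDl.
rewrite big_split/= -mulr_sumr sd mulr1.
have -> : \sum_(k < N) pi^-1 * J (interp_node R n k) * d k =
    pi^-1 * \sum_(k < N) d k * J (interp_node R n k).
  by rewrite mulr_sumr; apply: eq_bigr => k _; ring.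
ring.
Qed.

(** The bound B provides integrability, while the estimate depends on A alone and is ready for the
    infimum over T. *)
Lemma interp_error_le (f phi T : R -> R) (a0 A B : R) :
  measurable_fun [set: measurableTypeR R] phi ->
  0 <= B -> {ae mu, forall t, `|phi t| <= B} ->
  (forall y, f y = a0 / 2 + pi^-1 *
     \int[mu]_(t in `[- pi, pi]) (poisson_kernel alpha r beta (y - t) * phi t)) ->
  trig_space n T -> 0 <= A -> {ae mu, forall t, `|phi t - T t| <= A} ->
  `|interp_error n f x| <= `|W| * (c + 32) * A.
Proof.
move=> mphi B0 phiB fE TT A0 phiTA; have pi0 := pi_gt0 R.
have cQ : continuous Q by exact: (continuous_error_kernel r_gt0 r_lt1 alpha_gt0 nstarP).
have iphi (g : R -> R) a b : continuous g ->
    mu.-integrable `[a, b] (EFin \o (fun t => g t * phi t)).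
  by move=> cg; have [] := integrable_mul_ae_bounded a b B0 cg mphi phiB.
rewrite (interp_error_integral iphi fE).
have cT := continuous_trig TT.
have mT : measurable_fun [set: measurableTypeR R] T by exact: continuous_measurable_fun.
have -> : \int[mu]_(t in `[- pi, pi]) (Q t * phi t) =
    \int[mu]_(t in `[- pi, pi]) (Q t * (phi t - T t)).
  rewrite -[LHS]subr0 -(error_kernel_orthogonal beta x r_gt0 r_lt1 alpha_gt0 nstarP TT).
  rewrite -RintegralB//.
  - by apply: eq_Rintegral => t _; rewrite mulrBr.
  - exact: iphi.
  - by apply: continuous_integrable => t; apply: cvgM; [exact: cQ|exact: cT].
have mphiT : measurable_fun [set: measurableTypeR R] (fun t => phi t - T t).
  exact: measurable_funB.
have [_ H] := integrable_mul_ae_bounded (- pi) pi A0 cQ mphiT phiTA.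
rewrite normrM gtr0_norm ?invr_gt0//.
apply: (@le_trans _ _ (pi^-1 * (A * \int[mu]_(t in `[- pi, pi]) `|Q t|))).
  by rewrite ler_pM2l ?invr_gt0.
rewrite mulrCA mulrC ler_wpM2r//.
exact: error_kernel_L1.
Qed.

Lemma norm_error_weight :
  `|W| = 2 * expR (- alpha * n%:R `^ r) * `|sin ((2 * n%:R - 1) / 2 * x)|.
Proof.
rewrite /W !normrM (ger0_norm (expR_ge0 _)) (ger0_norm (ler0n R 2)) mulrAC.
by congr (_ * `|sin (_ / 2 * x)|); rewrite /N natN_half /n -natr1; ring.
Qed.

Lemma leading_term_ge0 : 0 <= c.
Proof.
have q0 : 0 < decay alpha r n by exact: decay_gt0.
have q1 : decay alpha r n <= 1 / 216 by exact: decay_le nstarP.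
rewrite /c mulr_ge0 ?divr_ge0 ?exprn_ge0 ?pi_ge0// ln_ge0//.
by rewrite -[leLHS]invr1 lef_pV2 ?posrE//; lra.
Qed.

Lemma interp_error_le_En_Linfty (f phi : R -> R) :
  gen_derivative (Linfty R) alpha r beta f phi ->
  `|interp_error n f x| <= `|W| * (c + 32) * En_Linfty n phi.
Proof.
move=> [_ [_ mphi phiN] _ [a0 fE]].
have W0 := normr_ge0 W; have c0 := leading_term_ge0.
set L := Lnorm _ _ _ in phiN.
have L0 : (0 <= L)%E by exact: Lnorm_ge0.
have Lfin : L = (fine L)%:E by rewrite fineK// ge0_fin_numE.
have phiB : {ae mu, forall t, `|phi t| <= fine L}.
  by apply: Lnorm_infty_ae; rewrite -Lfin.
have B0 : 0 <= fine L by exact: fine_ge0.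
rewrite /En_Linfty; set S := [set _ | _ in _].
have S0 : (0 <= ereal_inf S)%E.
  by apply: le_ereal_inf_tmp => _ [T _ <-]; exact: Lnorm_ge0.
have SL : (ereal_inf S <= L)%E.
  apply: ereal_inf_lbound; exists (fun=> 0); first exact: trig_space0.
  by rewrite /L; apply: eq_Lnorm => t /=; rewrite subr0.
have Sfin : ereal_inf S = (fine (ereal_inf S))%:E.
  by rewrite fineK// ge0_fin_numE// (le_lt_trans SL).
(* W vanishes at the nodes, where dividing by it is impossible; comparison with T = 0 then already
   gives a zero error. *)
have [K0|K0] := eqVneq (`|W| * (c + 32)) 0.
  rewrite K0 mul0r.
  have := interp_error_le mphi B0 phiB fE (trig_space0 R n) B0; rewrite K0 mul0r; apply.
  case: phiB => M [mM M0 sM]; exists M; split=> // t /= H.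
  by apply: sM => /= h; apply: H; rewrite subr0.
have Kpos : 0 < `|W| * (c + 32) by rewrite lt0r K0 mulr_ge0//; lra.
rewrite -ler_pdivrMl// -lee_fin -Sfin; apply: le_ereal_inf_tmp => _ [T TT <-].
set A := Lnorm _ _ _; have A0 : (0 <= A)%E by exact: Lnorm_ge0.
have [->|Ay] := eqVneq A +oo%E; first by rewrite leey.
have Afin : A = (fine A)%:E by rewrite fineK// ge0_fin_numE// lt_neqAle Ay leey.
rewrite Afin lee_fin ler_pdivrMl//.
apply: interp_error_le mphi B0 phiB fE TT (fine_ge0 A0) _.
by apply: Lnorm_infty_ae; rewrite -Afin.
Qed.

Lemma Cper_ae_bounded phi : Cper R phi ->
  measurable_fun [set: measurableTypeR R] phi /\
  exists2 B, 0 <= B & forall t, `|phi t| <= B.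
Proof.
move=> Cphi; split; first by apply: continuous_measurable_fun; case: Cphi.
have [B HB] := Cper_bounded Cphi; exists B => //.
by apply: le_trans (HB 0).
Qed.

Lemma ae_forall (S : R -> Prop) : (forall t, S t) -> {ae mu, forall t, S t}.
Proof.
move=> HS; exists set0; split => //.
by move=> t /=; apply; exact: HS.
Qed.

Lemma interp_error_le_En_C (f phi : R -> R) :
  gen_derivative (Cper R) alpha r beta f phi ->
  `|interp_error n f x| <= `|W| * (c + 32) * En_C n phi.
Proof.
move=> [_ Cphi _ [a0 fE]]; have W0 := normr_ge0 W; have c0 := leading_term_ge0.
have [mphi [B B0 phiB]] := Cper_ae_bounded Cphi.
have H T : trig_space n T ->
    `|interp_error n f x| <= `|W| * (c + 32) * supnorm (fun t => phi t - T t).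
  move=> TT; have [K TK] := trig_space_bounded TT.
  apply: interp_error_le mphi B0 (ae_forall phiB) fE TT (supnorm_ge0 _) _.
  apply: ae_forall => t; apply: (@le_supnorm R (fun t => phi t - T t) (B + K) t) => y.
  by apply: le_trans (ler_normB _ _) _; apply: lerD.
have [K0|K0] := eqVneq (`|W| * (c + 32)) 0.
  by have := H _ (trig_space0 R n); rewrite K0 !mul0r.
have Kpos : 0 < `|W| * (c + 32) by rewrite lt0r K0 mulr_ge0//; lra.
by rewrite -ler_pdivrMl//; apply: En_C_ge => T TT; rewrite ler_pdivrMl//; exact: H.
Qed.

Let psi := smoothed_sign alpha r beta p x.
Let m := (2 * pi)^-1 * \int[mu]_(t in `[- pi, pi]) psi t.

(** A generalized derivative must have integral zero. Removing the constant k m changes neither the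
    integral against Q nor the best approximation. *)
Definition extremal_derivative (k t : R) : R := k * psi t + - (k * m).

Definition extremal_function (k y : R) : R :=
  0 / 2 + pi^-1 *
    \int[mu]_(t in `[- pi, pi])
      (poisson_kernel alpha r beta (y - t) * extremal_derivative k t).

Lemma extremal_Cper k : Cper R (extremal_derivative k).
Proof.
split; first by move=> t; rewrite /extremal_derivative /psi smoothed_sign_periodic.
move=> t; apply: cvgD; last exact: cvg_cst.
by apply: cvgM; [exact: cvg_cst|exact: continuous_smoothed_sign].
Qed.

Lemma extremal_gen_derivative k :
  gen_derivative (Cper R) alpha r beta (extremal_function k) (extremal_derivative k).
Proof.
have pi0 := pi_gt0 R.
split.
- move=> y; rewrite /extremal_function; congr (_ + _ * _); apply: eq_Rintegral => t _.
  by rewrite addrAC poisson_kernel_periodic.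
- exact: extremal_Cper.
- have cpsi : continuous psi by exact: continuous_smoothed_sign.
  rewrite RintegralD//; last 2 first.
  + apply: continuous_integrable => t; apply: cvgM; first exact: cvg_cst.
    exact: cpsi.
  + by apply: continuous_integrable => t; exact: cvg_cst.
  rewrite RintegralZl//; last exact: continuous_integrable.
  rewrite Rintegral_itv_cst; last by lra.
  rewrite /m; move: (\int[mu]_(t in _) psi t) => J.
  by move: (lt0r_neq0 pi0); move: (pi) => z z0; field; rewrite ?z0.
- by exists 0.
Qed.

Lemma extremal_error_ge k : 0 <= k ->
  k * (`|W| * (c - 34)) <= `|interp_error n (extremal_function k) x|.
Proof.
move=> k0; have pi0 := pi_gt0 R.
have cQ : continuous Q by exact: (continuous_error_kernel r_gt0 r_lt1 alpha_gt0 nstarP).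
have cpsi : continuous psi by exact: continuous_smoothed_sign.
have [_ cE] := extremal_Cper k.
rewrite (@interp_error_integral _ (extremal_derivative k) 0)//; last first.
  move=> g a b cg; apply: continuous_integrable => t; apply: cvgM; [exact: cg|exact: cE].
have -> : \int[mu]_(t in `[- pi, pi]) (Q t * extremal_derivative k t) =
    k * \int[mu]_(t in `[- pi, pi]) (Q t * psi t).
  have iQpsi : mu.-integrable `[- pi, pi] (EFin \o (fun t => Q t * psi t)).
    by apply: continuous_integrable => t; apply: cvgM; [exact: cQ|exact: cpsi].
  rewrite -RintegralZl//.
  have T1 : trig_space n (fun=> - (k * m)) by exact: trig_space_cst.
  rewrite -[RHS]addr0 -(error_kernel_orthogonal beta x r_gt0 r_lt1 alpha_gt0 nstarP T1).
  rewrite -RintegralD//; last 2 first.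
  - apply: continuous_integrable => t; apply: cvgM; first exact: cvg_cst.
    by apply: cvgM; [exact: cQ|exact: cpsi].
  - by apply: continuous_integrable => t; apply: cvgM; [exact: cQ|exact: cvg_cst].
  by apply: eq_Rintegral => t _; rewrite /extremal_derivative -/Q; ring.
rewrite (normrM pi^-1) (normrM k) (ger0_norm k0) gtr0_norm ?invr_gt0//.
rewrite [leRHS]mulrCA ler_wpM2l//.
exact: error_kernel_smoothed_sign.
Qed.

Lemma En_C_extremal k : 0 < k ->
  En_C n (extremal_derivative k) = k * En_C n psi.
Proof. by move=> k0; apply: (En_C_affine _ _ k0 (@smoothed_sign_le1 _ _ _ _ _ _)). Qed.

Lemma En_C_smoothed_sign_le1 : En_C n psi <= 1.
Proof.
apply: le_trans (En_C_le _ (trig_space0 R n)) _; apply: supnorm_le => y.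
by rewrite subr0; exact: smoothed_sign_le1.
Qed.

(** Any F with the right best approximation and a large enough error will do: gamma is then defined
    as a quotient minus c, and the upper estimate gives gamma <= 32. *)
Lemma extremal_exists (f phi : R -> R) :
  gen_derivative (Cper R) alpha r beta f phi ->
  exists F Phi : R -> R,
    [/\ gen_derivative (Cper R) alpha r beta F Phi,
        En_C n Phi = En_C n phi
      & exists gamma : R, `|gamma| <= 34 /\
          `|interp_error n F x| = `|W| * (c + gamma) * En_C n phi].
Proof.
move=> fphi; have W0 := normr_ge0 W; have c0 := leading_term_ge0.
have E0 := En_C_ge0 n phi; set E := En_C n phi in E0 *.
have up := interp_error_le_En_C.
have gam F Phi : gen_derivative (Cper R) alpha r beta F Phi -> En_C n Phi = E ->
    `|W| * (c - 34) * E <= `|interp_error n F x| ->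
    exists gamma : R, `|gamma| <= 34 /\ `|interp_error n F x| = `|W| * (c + gamma) * E.
  move=> FPhi EE lo; have := up _ _ FPhi; rewrite EE => hi.
  (* If W or E vanishes, both sides are 0 and gamma = 0 is chosen. *)
  have [D0|D0] := eqVneq (`|W| * E) 0.
    exists 0; split; first by rewrite normr0.
    apply/eqP; rewrite addr0 mulrAC D0 mul0r normr_eq0 -normr_le0.
    by apply: le_trans hi _; rewrite mulrAC D0 mul0r.
  have Dpos : 0 < `|W| * E by rewrite lt0r D0 mulr_ge0.
  exists (`|interp_error n F x| / (`|W| * E) - c); split; last first.
    rewrite addrC subrK mulrAC mulrC mulfVK//.
  rewrite ler_norml; apply/andP; split.
    rewrite lerBrDr ler_pdivlMr//; move: lo; rewrite mulrAC mulrC; lra.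
  rewrite lerBlDr ler_pdivrMr//; apply: le_trans hi _.
  by rewrite mulrAC mulrC ler_pM2r//; lra.
(* When this quantity is not positive, the required lower bound is trivial and f itself serves as
   F. *)
have [WE|WE] := leP (`|W| * (c - 34) * E) 0.
  by exists f, phi; split => //; apply: (gam f phi) => //; exact: le_trans WE _.
have Epos : 0 < E by rewrite lt0r E0 andbT; apply: contraTneq WE => ->; rewrite mulr0 ltxx.
have Wc : 0 < `|W| * (c - 34) by move: WE; rewrite pmulr_lgt0.
(* If this distance were 0, the upper estimate would force a zero error for k = 1, against
   [extremal_error_ge]. *)
have e0 : 0 < En_C n psi.
  rewrite lt0r En_C_ge0 andbT; apply: contraTneq Wc => e0; rewrite -leNgt.
  have := extremal_error_ge ler01; rewrite mul1r => /le_trans; apply.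
  have := up _ _ (extremal_gen_derivative 1); rewrite En_C_extremal// e0 mul1r mulr0.
  done.
pose k := E / En_C n psi; have k0 : 0 < k by rewrite divr_gt0.
have EE : En_C n (extremal_derivative k) = E.
  by rewrite En_C_extremal// /k mulfVK// gt_eqF.
exists (extremal_function k), (extremal_derivative k); split => //.
  exact: extremal_gen_derivative.
apply: gam (extremal_gen_derivative k) EE _.
(* As the distance of psi is at most 1, k >= E, and the error is at least E times the bound for
   psi. *)
apply: le_trans (extremal_error_ge (ltW k0)); rewrite mulrC ler_pM2r//.
by rewrite /k ler_pdivlMr// ler_piMr// ?En_C_smoothed_sign_le1// ltW.
Qed.

End interpolation_error.

(** The inequality is assumed at n besides [nstar alpha r <= n], because it may fail beyond [nstar]
    when r is small. In (i), gamma is fixed before f and phi. *)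
Theorem mainTheorem3 (R : realType) (r alpha beta : R)
    (r_gt0 : 0 < r) (r_lt1 : r < 1) (alpha_gt0 : 0 < alpha) :
  (forall (x : R) (n : nat),
      (nstar alpha r <= n)%N -> nstar_ineq alpha r n ->
      exists gamma : R, `|gamma| < 20 * pi ^+ 4 /\
      forall f phi : R -> R,
        gen_derivative (Linfty R) alpha r beta f phi ->
        `|interp_error n f x| <=
          2 * expR (- alpha * n%:R `^ r) * `|sin ((2 * n%:R - 1) / 2 * x)| *
          (4 / pi ^+ 2 * ln (n%:R `^ (1 - r) / (alpha * r)) + gamma) *
          En_Linfty n phi)
  /\
  (forall (x : R) (f phi : R -> R) (n : nat),
      gen_derivative (Cper R) alpha r beta f phi ->
      (nstar alpha r <= n)%N -> nstar_ineq alpha r n ->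
      exists F Phi : R -> R,
        [/\ gen_derivative (Cper R) alpha r beta F Phi,
            En_C n Phi = En_C n phi
          & exists gamma : R, `|gamma| < 1951 /\
            `|interp_error n F x| =
              2 * expR (- alpha * n%:R `^ r) *
              `|sin ((2 * n%:R - 1) / 2 * x)| *
              (4 / pi ^+ 2 * ln (n%:R `^ (1 - r) / (alpha * r)) + gamma) *
              En_C n phi]).
Proof.
have decayV n : n%:R `^ (1 - r) / (alpha * r) = (decay alpha r n)^-1.
  by rewrite /decay invf_div.
have n_gt0 n : (nstar alpha r <= n)%N -> (0 < n)%N.
  exact: leq_trans (nstar_gt0 r_gt0 r_lt1 alpha_gt0).
split.
(* Positivity of n excludes n = 0, so n = p + 1; and 32 < 20 * 2^4 <= 20 pi^4. *)
- move=> x [|p] /n_gt0// _ nP; exists 32; split.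
    have pi4 : 2 ^+ 4 <= pi ^+ 4 :> R.
      by rewrite lerXn2r ?nnegrE ?pi_ge0// pi_ge2.
    by rewrite ger0_norm//; lra.
  move=> f phi fphi; rewrite decayV -norm_error_weight.
  exact: (interp_error_le_En_Linfty x r_gt0 r_lt1 alpha_gt0 nP fphi).
- move=> x f phi [|p] fphi /n_gt0// _ nP.
  have [F [Phi [FPhi EE [gamma [g34 FE]]]]] :=
    extremal_exists x r_gt0 r_lt1 alpha_gt0 nP fphi.
  exists F, Phi; split=> //; exists gamma; split; first by apply: le_lt_trans g34 _; lra.
  by rewrite decayV -norm_error_weight.
Qed.
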